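(* Let $F:\mathbf T\to\mathbf T$, $F(e^{ix})=e^{i\psi(x)}$, be a bi-Lipschitz mapping, let $f(t)=F(e^{it})$ for $t\in[0,2\pi]$, and let $w$ be the radial extension of $F$. Put $l=\mathrm{Lip}(f)$, $L=\mathrm{Lip}(F)$, $\Lambda=\mathrm{Lip}(w)$ and $\mathcal K=\mathrm{ess\,sup}_z D_w(z)$. Then $$l=L=\Lambda=\mathrm{Lip}(\psi)=|\psi'|_\infty,$$ $$\mathrm{Lip}(w^{-1})=\mathrm{Lip}(\psi^{-1})=|1/\psi'|_\infty,$$ and $$\mathcal K=\max\{|\psi'|_\infty,\,|1/\psi'|_\infty\}.$$
   Context: $\mathbf T$ is the unit circle in the complex plane $\mathbf C$, with the chordal distance $|z-w|$. A mapping $g$ between metric spaces is bi-Lipschitz if there are constants $0<\ell\le\mathcal L$ with $\ell\, d(x,y)\le d(g(x),g(y))\le \mathcal L\, d(x,y)$ for all $x,y$. $\mathrm{Lip}(g)=\sup_{x\ne y} d(g(x),g(y))/d(x,y)$. In particular $\mathrm{Lip}(f)=\sup_{t\neq s\in[0,2\pi]}|f(t)-f(s)|/|t-s|$ and $\mathrm{Lip}(F)=\sup_{e^{it}\ne e^{is}}|F(e^{it})-F(e^{is})|/|e^{it}-e^{is}|$. The function $\psi$ is a continuous real-valued function on $[0,2\pi]$ with $F(e^{ix})=e^{i\psi(x)}$ (a continuous lift of $F$), and $\psi^{-1}$ is its inverse, defined on the interval $\psi([0,2\pi])$. The radial extension of $F$ is $w(z)=|z|F(z/|z|)$ for $z\neq0$,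 $w(0)=0$; it is a homeomorphism of $\mathbf C$ onto itself (and of the closed unit disk onto itself). $|g|_\infty$ denotes the $L^\infty$ norm of $g$. For a mapping $w$ differentiable at $z$, with real differential $\nabla w(z)$, put $|\nabla w(z)|=\max_{|h|=1}|\nabla w(z)h|$, $l(\nabla w)(z)=\min_{|h|=1}|\nabla w(z)h|$ and $D_w(z)=|\nabla w(z)|/l(\nabla w)(z)$. *)

(* Defs.v *)
From HB Require Import structures.
From mathcomp Require Import all_boot all_order all_algebra.
From mathcomp Require Import complex.
From mathcomp Require Import all_classical all_reals all_analysis.
From mathcomp Require Import ess_sup_inf.

Set Implicit Arguments.
Unset Strict Implicit.
Unset Printing Implicit Defensive.

Import Order.TTheory GRing.Theory Num.Theory.
Import numFieldNormedType.Exports.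

Local Open Scope classical_set_scope.
Local Open Scope complex_scope.
Local Open Scope ring_scope.

(* The complex plane is [Rcomplex R], i.e. [R[i]] regarded as a real vector
   space with the R-valued modulus; the real-closed library stops at the norm,
   so the topology induced by that norm is added here. It makes ['d g z] the
   real differential of [g : C -> C], only R-linear in general. *)
Section Rcomplex_normedModType.
Variable R : realType.

HB.instance Definition _ :=
  PseudoMetric.copy (Rcomplex R) (pseudoMetric_normed (Rcomplex R)).
HB.instance Definition _ := isPointed.Build (Rcomplex R) 0.
HB.instance Definition _ :=
  NormedZmod_PseudoMetric_eq.Build R (Rcomplex R) erefl.

Lemma Rcomplex_normrZ (a : R) (z : Rcomplex R) : `|a *: z| = `|a| * `|z|.
Proof.
case: z => x y; rewrite /Num.norm/= -[LHS]/(Num.sqrt ((a * x) ^+ 2 + (a * y) ^+ 2)).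
by rewrite !exprMn -mulrDr sqrtrM ?sqr_ge0// sqrtr_sqr.
Qed.

HB.instance Definition _ :=
  PseudoMetricNormedZmod_Lmodule_isNormedModule.Build R (Rcomplex R)
    Rcomplex_normrZ.

End Rcomplex_normedModType.

Section definitions.
Context {R : realType}.
Notation C := (Rcomplex R).

Definition bilipschitz_on (V W : normedZmodType R) (A : set V) (g : V -> W) :=
  exists l L : R, [/\ 0 < l, l <= L & forall x y, A x -> A y ->
    l * `|x - y| <= `|g x - g y| <= L * `|x - y|].

Definition Lip (V W : normedZmodType R) (A : set V) (g : V -> W) : \bar R :=
  ereal_sup [set (`|g p.1 - g p.2| / `|p.1 - p.2|)%:E
            | p in [set p : V * V | [/\ A p.1, A p.2 & p.1 <> p.2]]].

Definition circle : set C := [set z | `|z| = 1].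

Definition cis (t : R) : C := cos t +i* sin t.

Definition radial (F : C -> C) (z : C) : C :=
  if z == 0 then 0 else `|z| *: F (`|z|^-1 *: z).

Definition interval02pi : set R := `[0, 2 * pi]%classic.

Lemma measurable_interval02pi :
  measurable (interval02pi : set (measurableTypeR R)).
Proof. exact: measurable_itv. Qed.

Definition Linf (g : R -> \bar R) : \bar R :=
  'N[mrestr (@lebesgue_measure R) measurable_interval02pi]_+oo[g].

(* The unit circle is compact, so these supremum and infimum are the maximum
   and the minimum. Where [g] is not differentiable, ['d g z] is an unspecified
   linear map. *)
Definition max_stretch (g : C -> C) (z : C) : R :=
  sup [set `|'d g z h| | h in circle].

Definition min_stretch (g : C -> C) (z : C) : R :=
  inf [set `|'d g z h| | h in circle].

(* The division is that of the extended reals, with [0^-1 = +oo]. *)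
Definition distortion (g : C -> C) (z : C) : \bar R :=
  ((max_stretch g z)%:E / (min_stretch g z)%:E)%E.

Definition ess_sup_plane (D : C -> \bar R) : \bar R :=
  ess_sup (@lebesgue_measure R \x @lebesgue_measure R)%E
    (fun p => D (p.1 +i* p.2)).

End definitions.

(* Main.v *)
From HB Require Import structures.
Require Import Defs.
From mathcomp Require Import all_boot all_order all_algebra.
From mathcomp Require Import complex.
From mathcomp Require Import all_classical all_reals all_analysis.
From mathcomp Require Import measurable_realfun ess_sup_inf.
From mathcomp Require Import ring lra.

Set Implicit Arguments.
Unset Strict Implicit.
Unset Printing Implicit Defensive.

Import Order.TTheory GRing.Theory Num.Theory.
Import numFieldNormedType.Exports.

Local Open Scope classical_set_scope.
Local Open Scope ring_scope.

(** Every quantity in the theorem is an element of the extended reals, and two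
    such elements are equal as soon as they have the same real upper bounds.
    So each equality becomes an equivalence between two Lipschitz-type
    inequalities with one and the same constant [M].

    As [F] is injective, its continuous lift [psi] is monotone on
    [[0, 2 * pi]], with total increment [2 * pi] in absolute value
    ([psi_turn]).  Let [alpha] and [beta] be two nondecreasing continuous
    functions with that total increment.  Then the inequality of increments [alpha t - alpha s <= M * (beta t - beta s)] is
    equivalent to the inequality of chords
    [`|cis (alpha s) - cis (alpha t)| <= M * `|cis (beta s) - cis (beta t)|].
    In one direction ([chord_le_of_turn_le]) this is the concavity of the sine,
    applied to the shorter of the two complementary arcs, [M >= 1] being forced
    by the total increments.  In the other one ([turn_le_of_chord_le]) an arc is
    halved again and again, and the chords of the pieces add up to its length in
    the limit.
    Taking for [(alpha, beta)] the pair formed by [psi] and the identity, in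
    both orders, gives the statements on [F] and on its inverse.  They pass to
    the radial extension because
    [`|r *: a - s *: b| ^+ 2 = (r - s) ^+ 2 + r * s * `|a - b| ^+ 2] for [a] and
    [b] on the unit circle and because [M >= 1] ([radial_dist]).

    The constants of [psi] are read off its derivative because a Lipschitz
    monotone function is differentiable almost everywhere and is the integral
    of its derivative ([lipschitz_monotone_FTC]).  Its Lebesgue-Stieltjes measure
    is absolutely continuous, and the Lebesgue differentiation theorem applies
    to the Radon-Nikodym density.  Hence [c * (t - s) <= d * (psi t - psi s)] for
    all [s <= t] if and only if [c <= d * psi'] almost everywhere
    ([ae_derive_ge]).

    Finally, at [r *: cis t], where [psi] has derivative [d] at [t], the
    differential of the radial extension has singular values [1] and [`|d|], in
    the radial and in the tangential direction ([radial_diff]), so that its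
    distortion is the maximum of [`|d|] and [`|d|^-1].  A property of the polar
    angle holds for almost every angle if and only if it holds for almost every
    point of the plane ([ae_polar_plane], [ae_plane_polar]).  By Fubini's theorem
    it suffices to look at vertical lines, on which the angle is an arctangent,
    bi-Lipschitz on bounded sets, and therefore preserves null sets in both
    directions ([negligible_preimage_expanding]). *)

(** * Lebesgue null sets *)

Section null_sets.
Context {R : realType}.
Local Notation mu := (@lebesgue_measure R).
Implicit Types (N A : set R) (G : R -> R).

Lemma null_set_cover N (e : R) : mu N = 0%E -> 0 < e ->
  exists I : nat -> R * R, [/\ forall k, (I k).1 <= (I k).2,
    N `<=` \bigcup_k `](I k).1, (I k).2]%classic &
    (\sum_(k <oo) ((I k).2 - (I k).1)%R%:E < e%:E)%E].
Proof.
move=> N0 e0.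
have /ereal_inf_lt[_ [A [mA NA] <-] Ae] : (mu N < e%:E)%E by rewrite N0 lte_fin.
have /choice[I IA] : forall k, exists p : R * R,
    p.1 <= p.2 /\ A k = `]p.1, p.2]%classic.
  move=> k; have [->|[p p12 ->]] := (@ocitvP R _).1 (mA k).
    by exists (0, 0) => /=; rewrite set_itv_ge// bnd_simp ltxx.
  by exists p; rewrite ltW.
exists I; split; first by move=> k; have [] := IA k.
  by move=> x /NA[k _ Akx]; exists k => //; have [_ <-] := IA k.
move: Ae; congr (_ < _)%E; apply: eq_eseriesr => k _.
have [Ik AE] := IA k; rewrite AE.
exact: (wlength_itv_bnd idfun _ _ Ik).
Qed.

(** Equivalently, the image of a null set under a Lipschitz map is null.  No
    measurability of [G] is needed: intervals covering [N] pull back to sets of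
    comparable diameter, which are enlarged to intervals. *)
Lemma negligible_preimage_expanding N A G (K : R) :
  mu.-negligible N -> 0 < K ->
  (forall s t, A s -> A t -> `|s - t| <= K * `|G s - G t|) ->
  mu.-negligible (A `&` G @^-1` N).
Proof.
move=> [N' [mN' N'0 NN']] K0 AG.
have H (e : R) : 0 < e -> exists U : set R, [/\ measurable U,
    A `&` G @^-1` N `<=` U & (mu U <= e%:E)%E].
  move=> e0.
  have e'0 : 0 < e / (2 * K) by rewrite divr_gt0// mulr_gt0.
  have [I [I12 NI Ie]] := null_set_cover N'0 e'0.
  pose d k := K * ((I k).2 - (I k).1).
  have d0 k : 0 <= d k by rewrite mulr_ge0// ?subr_ge0// ltW.
  have /choice[c Hc] : forall k, exists c : R, A `&` G @^-1` `](I k).1, (I k).2] `<=`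
      `[c - d k, c + d k]%classic.
    (* any point of the preimage will do as a centre *)
    move=> k; have [[c [Ac Gc]]|noc] :=
      pselect (exists c, A c /\ G c \in `](I k).1, (I k).2]%R).
      exists c => t [At /=]; move: Gc; rewrite !in_itv/= => /andP[c1 c2] /andP[t1 t2].
      rewrite -ler_distlC distrC; apply: (le_trans (AG _ _ At Ac)).
      rewrite ler_pM2l// ler_norml; apply/andP; split; lra.
    by exists 0 => t [At Gt]; exfalso; apply: noc; exists t; split.
  pose B k : set R := `[c k - d k, c k + d k]%classic.
  exists (\bigcup_k B k); split.
  - by apply: bigcup_measurable => k _; exact: measurable_itv.
  - move=> t [At /NN' /NI [k _ Ik]]; exists k => //.
    by apply: Hc; split.
  - apply: (@le_trans _ _ (\sum_(k <oo) mu (B k))%E).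
      apply: measure_sigma_subadditive => //; first by move=> k; exact: measurable_itv.
      by apply: bigcup_measurable => k _; exact: measurable_itv.
    rewrite (_ : e%:E = (2 * K)%R%:E * (e / (2 * K))%R%:E)%E; last first.
      by rewrite -EFinM mulrC divfK// mulf_neq0// gt_eqF.
    apply: (@le_trans _ _ ((2 * K)%R%:E * (\sum_(k <oo) ((I k).2 - (I k).1)%R%:E))%E).
      rewrite -nneseriesZl//; last by move=> k _; rewrite lee_fin subr_ge0.
      apply: lee_nneseries => // k _.
      rewrite /B lebesgue_measure_itv/= lte_fin; case: ifPn => _.
        by rewrite -EFinB -EFinM lee_fin /d; lra.
      by rewrite -EFinM lee_fin !mulr_ge0// ?subr_ge0// ltW.
    by rewrite lee_pmul2l// ?lte_fin ?mulr_gt0//; exact: ltW.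
have /choice[U HU] : forall n : nat, exists U : set R, [/\ measurable U,
    A `&` G @^-1` N `<=` U & (mu U <= (n.+1%:R^-1)%:E)%E].
  by move=> n; apply: H; rewrite invr_gt0.
have mU : measurable (\bigcap_n U n).
  by apply: bigcap_measurable => // n _; have [] := HU n.
exists (\bigcap_n U n); split => //.
  apply/eqP; rewrite -measure_le0; apply/lee_addgt0Pr => e e0; rewrite add0e.
  have [n ne] : exists n : nat, n.+1%:R^-1 < e.
    have := near_infty_natSinv_lt (PosNum e0) => -[n _ /(_ n (leqnn n))].
    by exists n.
  apply: (@le_trans _ _ (mu (U n))).
    by apply: le_measure; rewrite ?inE//; [have [] := HU n|exact: bigcap_inf].
  have [_ _ /le_trans->//] := HU n.
  by rewrite lee_fin ltW.
by move=> t At n _; have [_ + _] := HU n; exact.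
Qed.

End null_sets.

(** * Lipschitz monotone functions of a real variable *)

Section lipschitz_ftc.
Context {R : realType}.
Local Notation mu := (@lebesgue_measure R).

Lemma lipschitz_right_continuous (f : R -> R) (K : R) :
  (forall x y, `|f x - f y| <= K * `|x - y|) ->
  forall x, f y @[y --> x^'+] --> f x.
Proof.
move=> fK x; apply: cvg_at_right_filter; apply/cvgrPdist_le => /= e e0.
have K1 : 0 < `|K| + 1 by rewrite ltr_wpDl.
near=> y; apply: (le_trans (fK x y)).
apply: (@le_trans _ _ ((`|K| + 1) * `|x - y|)).
  by rewrite ler_wpM2r//; have := ler_norm K; lra.
rewrite -ler_pdivlMl// mulrC; near: y.
by apply: cvgr_dist_le => //; rewrite divr_gt0.
Unshelve. all: by end_near. Qed.

(** The Lebesgue-Stieltjes measure of a Lipschitz function is absolutely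
    continuous: an interval has measure at most [K] times its length. *)
Lemma stieltjes_dominated (f : cumulative R R) (K : R) (N : set R) :
  (forall x y, `|f x - f y| <= K * `|x - y|) -> mu N = 0%E ->
  lebesgue_stieltjes_measure f N = 0%E.
Proof.
move=> fK N0; apply/eqP.
rewrite eq_le outer_measure_ge0 andbT.
apply/lee_addgt0Pr => e e0; rewrite add0e.
have K1 : 0 < `|K| + 1 by rewrite ltr_wpDl.
have [I [I12 NI Ie]] := null_set_cover N0 (divr_gt0 e0 K1).
apply: (@le_trans _ _ (\sum_(k <oo) wlength f `](I k).1, (I k).2]%classic)%E).
  apply: ereal_inf_lbound; exists (fun k => `](I k).1, (I k).2]%classic) => //.
  by split => // k; exact: is_ocitv.
have -> : e%:E = ((`|K| + 1)%R%:E * (e / (`|K| + 1))%R%:E)%E.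
  by rewrite -EFinM mulrC divfK// gt_eqF.
apply: (@le_trans _ _ ((`|K| + 1)%R%:E *
    (\sum_(k <oo) ((I k).2 - (I k).1)%R%:E))%E); last first.
  by rewrite lee_pmul2l// ltW.
rewrite -nneseriesZl//; last by move=> k _; rewrite lee_fin subr_ge0.
apply: lee_nneseries => // k _.
rewrite wlength_itv_bnd// -EFinM lee_fin.
apply: (le_trans (ler_norm _)); apply: (le_trans (fK _ _)).
rewrite (ger0_norm (_ : 0 <= (I k).2 - (I k).1)) ?subr_ge0//.
by rewrite ler_wpM2r ?subr_ge0//; have := ler_norm K; lra.
Qed.

Lemma lipschitz_nondecreasing_density (f : R -> R) (K a b : R) :
  {homo f : x y / x <= y} -> (forall x y, `|f x - f y| <= K * `|x - y|) ->
  exists g : R -> R, mu.-integrable [set: R] (EFin \o g) /\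
    forall s t, a <= s -> s <= t -> t <= b ->
      (f t - f s)%:E = (\int[mu]_(x in `]s, t]) (g x)%:E)%E.
Proof.
move=> fnd fK.
pose c : cumulative R R :=
  HB.pack f (isCumulative.Build R _ R f fnd (lipschitz_right_continuous fK)).
pose ls : {measure set (measurableTypeR R) -> \bar R} := lebesgue_stieltjes_measure c.
have lsE s t : s <= t -> ls `]s, t]%classic = (f t - f s)%:E.
  move=> st; rewrite /ls/= /lebesgue_stieltjes_measure /measure_extension.
  rewrite measurable_mu_extE/=; last exact: is_ocitv.
  by rewrite (wlength_itv_bnd c).
have mab : measurable (`]a, b]%classic : set (measurableTypeR R)).
  exact: measurable_itv.
have lsfin : (ls `]a, b]%classic < +oo)%E.
  have [ab|ba] := leP a b; first by rewrite lsE// ltry.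
  by rewrite set_itv_ge ?bnd_simp -?leNgt ?(ltW ba)// measure0.
(* the restriction to ]a, b] makes the Stieltjes measure finite *)
pose nu : {finite_measure set (measurableTypeR R) -> \bar R} := mfrestr mab lsfin.
have numu : nu `<< mu.
  move=> N N0 A mA AN; apply/eqP; rewrite -measure_le0.
  apply: (@le_trans _ _ (ls A)).
    apply: le_measure; rewrite ?inE//; exact: measurableI.
  by have /= -> := @stieltjes_dominated c K A fK (N0 A mA AN).
have [g [g0 gfin gint gE]] := radon_nikodym_sigma_finite numu.
exists (fine \o g); split.
  by apply: eq_integrable gint => // x _ /=; rewrite fineK.
move=> s t sa st tb.
under eq_integral do rewrite /= fineK//.
rewrite -gE; last exact: measurable_itv.
rewrite -lsE// /nu /= /mfrestr /mrestr setIidl//.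
by apply: subset_itv; rewrite bnd_simp.
Qed.

(** The projection of [x] onto [[a, b]], for [a <= b]. *)
Definition clamp (a b x : R) : R := Num.min (Num.max x a) b.

(** [psi] is nondecreasing on [[a, b]]; nothing is required outside. *)
Definition nondecreasing_on (a b : R) (psi : R -> R) :=
  forall x y, a <= x -> x <= y -> y <= b -> psi x <= psi y.

(** A Lipschitz nondecreasing function is differentiable almost everywhere, and
    is the integral of its derivative.  The endpoints are left out because
    [psi] is arbitrary outside [[a, b]], whereas [derive1] is two-sided. *)
Lemma lipschitz_nondecreasing_FTC (psi : R -> R) (K a b : R) : a < b ->
  nondecreasing_on a b psi ->
  (forall x y, a <= x -> x <= y -> y <= b -> psi y - psi x <= K * (y - x)) ->
  exists g : R -> R, [/\ mu.-integrable [set: R] (EFin \o g),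
    forall s t, a <= s -> s <= t -> t <= b ->
      (psi t - psi s)%:E = (\int[mu]_(x in `]s, t]) (g x)%:E)%E &
    {ae mu, forall x, x \in `]a, b[%R -> derivable psi x 1 /\ derive1 psi x = g x}].
Proof.
move=> ab psind psiK.
have clampP x : a <= clamp a b x <= b.
  by rewrite /clamp le_min le_max lexx orbT (ltW ab) ge_min lexx orbT.
have clampid x : a <= x -> x <= b -> clamp a b x = x.
  by move=> ax xb; rewrite /clamp (max_idPl ax) (min_idPl xb).
have clampnd : {homo clamp a b : x y / x <= y}.
  move=> x y xy; rewrite /clamp le_min ge_min ge_max le_max xy/=.
  by rewrite le_max lexx !orbT/= ge_min lexx orbT.
have clampK x y : x <= y -> clamp a b y - clamp a b x <= y - x.
  move=> xy; rewrite /clamp; case: (leP x a) => ?; case: (leP y a) => ?;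
  by case: (leP a b) => ?; case: (leP x b) => ?; case: (leP y b) => ?; lra.
(* extending psi by constants makes the hypotheses global *)
pose f x := psi (clamp a b x).
have fnd : {homo f : x y / x <= y}.
  move=> x y xy; have /andP[? ?] := clampP x; have /andP[? ?] := clampP y.
  by apply: psind => //; exact: clampnd.
have fK x y : `|f x - f y| <= `|K| * `|x - y|.
  wlog xy : x y / x <= y.
    move=> H; have [/H//|/ltW /H] := leP x y.
    by rewrite distrC (distrC y x).
  rewrite distrC (ger0_norm (_ : 0 <= f y - f x)) ?subr_ge0 ?fnd//.
  rewrite distrC (ger0_norm (_ : 0 <= y - x)) ?subr_ge0//.
  have /andP[? ?] := clampP x; have /andP[? ?] := clampP y.
  apply: (@le_trans _ _ (K * (clamp a b y - clamp a b x))).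
    by apply: psiK => //; exact: clampnd.
  apply: (@le_trans _ _ (`|K| * (clamp a b y - clamp a b x))).
    by rewrite ler_wpM2r ?ler_norm// subr_ge0; exact: clampnd.
  by rewrite ler_wpM2l//; exact: clampK.
have [g [gint gE]] := @lipschitz_nondecreasing_density f `|K| a b fnd fK.
have psiE s t : a <= s -> s <= t -> t <= b ->
    (psi t - psi s)%:E = (\int[mu]_(x in `]s, t]) (g x)%:E)%E.
  move=> sa st tb; rewrite -gE// /f !clampid//.
  - exact: le_trans tb.
  - exact: le_trans st.
exists g; split => //.
have gloc : locally_integrable [set: R] g.
  by apply: open_integrable_locally => //; exact: openT.
have intg y : mu.-integrable [set` Interval (BLeft a) (BRight y)] (EFin \o g).
  by apply: integrableS gint.
have := FTC1 intg gloc; apply: filterS; first exact: (ae_filter_ringOfSetsType mu).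
move=> x /[swap].
rewrite in_itv/= => /andP[ax xb] FTCx.
move: FTCx; rewrite lte_fin => /(_ ax).
set F := fun x => _.
have near_E : {near x, F =1 (fun y => psi y - psi a)}.
  near=> y.
  have /andP[ya yb] : a < y < b by near: y; apply: near_in_itvoo; rewrite in_itv/= ax.
  rewrite /F /Rintegral -integral_itv_obnd_cbnd; last first.
    apply: (measurable_int mu); exact: integrableS gint.
  by rewrite -psiE ?(ltW ya) ?(ltW yb).
move=> [dF FE].
have dG : derivable (fun y => psi y - psi a) x 1 := near_eq_derivable near_E dF.
have psiE' : psi = (fun y => psi y - psi a) + cst (psi a).
  by apply/funext => y; rewrite /= !fctE subrK.
have dpsi : derivable psi x 1 by rewrite psiE'; exact: derivableD.
split => //.
rewrite -FE !derive1E (near_eq_derive _ near_E).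
by rewrite deriveB// derive_cst subr0.
Unshelve. all: by end_near. Qed.

Lemma lipschitz_monotone_FTC (psi : R -> R) (K a b : R) : a < b ->
  nondecreasing_on a b psi \/ nondecreasing_on a b (\- psi) ->
  (forall x y, a <= x -> x <= y -> y <= b -> `|psi y - psi x| <= K * (y - x)) ->
  exists g : R -> R, [/\ mu.-integrable [set: R] (EFin \o g),
    forall s t, a <= s -> s <= t -> t <= b ->
      (psi t - psi s)%:E = (\int[mu]_(x in `]s, t]) (g x)%:E)%E &
    {ae mu, forall x, x \in `]a, b[%R -> derivable psi x 1 /\ derive1 psi x = g x}].
Proof.
move=> ab [psind|psini] psiK.
  apply: (@lipschitz_nondecreasing_FTC psi K) => // x y ax xy yb.
  by apply: le_trans (psiK x y ax xy yb); exact: ler_norm.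
have [g [gint gE gd]] : exists g : R -> R, [/\ mu.-integrable [set: R] (EFin \o g),
    forall s t, a <= s -> s <= t -> t <= b ->
      ((\- psi) t - (\- psi) s)%:E = (\int[mu]_(x in `]s, t]) (g x)%:E)%E &
    {ae mu, forall x, x \in `]a, b[%R ->
      derivable (\- psi) x 1 /\ derive1 (\- psi) x = g x}].
  apply: (@lipschitz_nondecreasing_FTC _ K) => // x y ax xy yb /=.
  apply: le_trans (psiK x y ax xy yb).
  by rewrite -normrN opprB; apply: le_trans (ler_norm _); lra.
exists (\- g); split.
- exact: (integrableN gint).
- move=> s t sa st tb; have /= := gE s t sa st tb.
  have gst : mu.-integrable `]s, t] (EFin \o g) by exact: integrableS gint.
  move=> gE'; rewrite -[RHS]/(\int[mu]_(x in `]s, t]) (- (g x)%:E))%E.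
  rewrite integralN -?gE'; last exact: integrable_add_def gst.
  by rewrite -EFinN; congr EFin; lra.
- move: gd; apply: filterS; first exact: (ae_filter_ringOfSetsType mu).
  move=> x gx xab; have [dx gxE] := gx xab.
  have psiE : psi = \- (\- psi) by apply/funext => y /=; rewrite opprK.
  have dpsi : derivable psi x 1 by rewrite psiE; exact: derivableN.
  by split => //; rewrite /= -gxE !derive1E [in LHS]psiE deriveN.
Qed.

(** Taking [(c, d)] equal to [(- M, -1)], [(1, M)] or [(0, 1)] (for [psi]
    nondecreasing) turns a Lipschitz bound, an expansion bound and monotonicity
    into almost everywhere bounds on the derivative. *)
Lemma ae_derive_ge (psi : R -> R) (K a b c d : R) : a < b ->
  nondecreasing_on a b psi \/ nondecreasing_on a b (\- psi) ->
  (forall x y, a <= x -> x <= y -> y <= b -> `|psi y - psi x| <= K * (y - x)) ->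
  (forall s t, a <= s -> s <= t -> t <= b -> c * (t - s) <= d * (psi t - psi s))
  <-> {ae mu, forall x, x \in `]a, b[%R -> c <= d * derive1 psi x}.
Proof.
move=> ab mono psiK.
have [g [gint gE gd]] := lipschitz_monotone_FTC ab mono psiK.
split=> [H|H].
  move: gd; apply: filterS; first exact: (ae_filter_ringOfSetsType mu).
  move=> x gx xab; have [+ _] := gx xab.
  rewrite derive1E => dx.
  have : d * (h^-1 * (psi (h + x) - psi x)) @[h --> 0^'] --> d * 'D_1 psi x.
    apply: cvgMr => /=.
    have := dx; rewrite /derivable /derive.
    by under eq_fun do rewrite [_ *: 1]mulr1.
  move=> /cvgr_to_ge; apply.
  have hx : (h + x) @[h --> 0^'] --> x.
    rewrite -[X in _ --> X]add0r; apply: cvgD; last exact: cvg_cst.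
    by apply: cvg_within_filter; exact: cvg_id.
  have hxI : \forall h \near 0^', h + x \in `]a, b[%R.
    exact: (hx _ (near_in_itvoo xab)).
  near=> h.
  have h0 : h != 0 by near: h; exact: nbhs_dnbhs_neq.
  have : h + x \in `]a, b[%R by near: h.
  move: xab; rewrite !in_itv/= => /andP[ax xb] /andP[ahx hxb].
  rewrite mulrCA mulrC.
  case: (ltgtP h 0) => [hlt|hgt|/eqP]; last by rewrite (negbTE h0).
    rewrite -[_ * h^-1]opprK -mulrN -invrN -mulNr ler_pdivlMr ?oppr_gt0//.
    have := H (h + x) x (ltW ahx) _ (ltW xb).
    by rewrite gerDr (ltW hlt) => /(_ isT); lra.
  rewrite ler_pdivlMr//.
  have := H x (h + x) (ltW ax) _ (ltW hxb).
  by rewrite lerDr (ltW hgt) => /(_ isT); lra.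
move=> s t sa st tb.
have mst : measurable (`]s, t[%classic : set (measurableTypeR R)).
  exact: measurable_itv.
have moc : measurable (`]s, t]%classic : set (measurableTypeR R)).
  exact: measurable_itv.
have stoc : (`]s, t[%classic : set R) `<=` `]s, t]%classic.
  by apply: subset_itvl; rewrite bnd_simp.
have gst : mu.-integrable `]s, t] (EFin \o g) by exact: integrableS gint.
have cint : mu.-integrable `]s, t] (EFin \o cst c).
  apply: (@integrableS _ _ _ mu `[s, t]) => //.
    by apply: subset_itvr; rewrite bnd_simp.
  apply: continuous_compact_integrable; first exact: segment_compact.
  by apply: continuous_subspaceT => x; exact: cvg_cst.
pose h x := d * g x - c.
have hint : mu.-integrable `]s, t] (EFin \o h).
  have := integrableB moc (integrableZl moc d gst) cint.
  by apply: eq_integrable => //.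
have hE : (d * (psi t - psi s) - c * (t - s))%:E =
    (\int[mu]_(x in `]s, t]) (h x)%:E)%E.
  have ic : (\int[mu]_(x in `]s, t]) c%:E = c%:E * mu `]s, t]%classic)%E.
    exact: integral_cst.
  have -> : (\int[mu]_(x in `]s, t]) (h x)%:E =
      \int[mu]_(x in `]s, t]) (d%:E * (g x)%:E - c%:E))%E by [].
  rewrite integralB//; last exact: integrableZl.
  rewrite integralZl// -gE// ic lebesgue_measure_itv/= lte_fin.
  case: ltP => ts; first by [].
  have -> : s = t by lra.
  by rewrite mule0 !subrr !mulr0 subr0 mule0 sube0.
rewrite -subr_ge0 -lee_fin hE.
rewrite -integral_itv_bndo_bndc; last first.
  by apply: (measurable_int mu); exact: integrableS hint.
(* h is almost everywhere nonnegative, hence equal to its positive part *)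
rewrite (@ae_eq_integral _ _ _ mu _ (EFin \o (fun x => Num.max (h x) 0)))//.
- by apply: integral_ge0 => x _; rewrite lee_fin le_max lexx orbT.
- by apply: (measurable_int mu); exact: integrableS hint.
- apply/measurable_EFinP; apply: measurable_maxr; last exact: measurable_cst.
  apply/measurable_EFinP; apply: (measurable_int mu); exact: integrableS hint.
- move: H gd; apply: filterS2; first exact: (ae_filter_ringOfSetsType mu).
  move=> x Hx gx; rewrite /= in_itv/= => /andP[sx xt].
  have xab : x \in `]a, b[%R by rewrite in_itv/=; apply/andP; split; lra.
  have [_ gE'] := gx xab; have := Hx xab; rewrite gE' => ?.
  by rewrite (max_idPl _)// /h; lra.
Unshelve. all: by end_near. Qed.

End lipschitz_ftc.

(** * Null sets in polar coordinates *)

Section polar.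
Context {R : realType}.
Local Notation mT := (measurableTypeR R).
Local Notation mu := (@lebesgue_measure R).
Local Notation mu2 := (@lebesgue_measure R \x @lebesgue_measure R)%E.

Lemma product_null_sections (A : set (mT * mT)) : measurable A ->
  mu2 A = 0%E <-> {ae mu, forall x : mT, mu (xsection A x) = 0%E}.
Proof.
move=> mA.
have mf := measurable_fun_xsection mu mA.
have := ae_eq_integral_abs mu measurableT mf.
have -> : (\int[mu]_(x in [set: mT]) `|(mu \o xsection A) x|)%E = mu2 A.
  by apply: eq_integral => x _; rewrite gee0_abs.
move=> ->; split; apply: filterS; do ?exact: ae_filter_ringOfSetsType.
  by move=> x /(_ I).
by move=> x /= -> .
Qed.

Lemma atan_le_dist (u v : R) : `|atan u - atan v| <= `|u - v|.
Proof.
wlog uv : u v / v <= u.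
  by move=> H; have [/H//|/ltW /H] := leP v u; rewrite distrC (distrC v).
have [c _ ->] := MVT_segment uv (fun x _ => is_derive1_atan x)
  (continuous_subspaceT (@continuous_atan R)).
rewrite normrM ler_piMl// ger0_norm; last by rewrite invr_ge0 addr_ge0// sqr_ge0.
by rewrite invf_le1 ?lerDl ?sqr_ge0// ltr_wpDr// sqr_ge0.
Qed.

Lemma dist_le_atan (n u v : R) : `|u| <= n -> `|v| <= n ->
  `|u - v| <= (1 + n ^+ 2) * `|atan u - atan v|.
Proof.
wlog uv : u v / v <= u.
  move=> H un vn; have [/H|/ltW /H] := leP v u; first exact.
  by rewrite distrC (distrC (atan v)); exact.
move=> un vn.
have [c cuv ->] := MVT_segment uv (fun x _ => is_derive1_atan x)
  (continuous_subspaceT (@continuous_atan R)).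
have c1 : 0 < 1 + c ^+ 2 by rewrite ltr_wpDr// sqr_ge0.
rewrite normrM mulrA ler_peMl// ger0_norm; last by rewrite invr_ge0 ltW.
rewrite -[_ * _]/(_ / _) ler_pdivlMr// mul1r lerD2l.
rewrite -(real_normK (num_real c)) ler_sqr ?nnegrE//; last exact: le_trans un.
move: cuv un vn; rewrite in_itv/= !ler_norml => /andP[? ?] /andP[? ?] /andP[? ?].
by apply/andP; split; lra.
Qed.

(** A polar angle of [p], provided that [p.1] has the sign of [(-1) ^+ k]; the
    values 0, 1, 2 of [k] cover the angles between 0 and [2 * pi].  When [p.1]
    is zero, the quotient is zero too and the value is meaningless. *)
Definition angle (k : nat) (p : R * R) : R := atan (p.2 / p.1) + pi *+ k.

Lemma negligible_angle_section (N : set R) (k : nat) (x : R) : x != 0 ->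
  mu.-negligible N -> mu.-negligible [set y : R | N (angle k (x, y))].
Proof.
move=> x0 N0.
pose A n : set R := [set y | `|y| <= n%:R].
have -> : [set y | N (angle k (x, y))] =
    \bigcup_n (A n `&` (fun y => angle k (x, y)) @^-1` N).
  apply/seteqP; split => y; last by move=> [n _ []].
  move=> Ny; exists (Num.bound `|y|) => //; split => //.
  by rewrite /A /=; apply/ltW/archi_boundP.
apply: negligible_bigcup => n.
have nx0 : 0 < `|x| by rewrite normr_gt0.
apply: (@negligible_preimage_expanding _ _ _ _ (`|x| * (1 + (n%:R / `|x|) ^+ 2))) => //.
  by rewrite mulr_gt0// ltr_wpDr// sqr_ge0.
move=> s t As At.
have le_n y : A n y -> `|y / x| <= n%:R / `|x|.
  by rewrite /A/= => yn; rewrite normrM normfV ler_pM2r// invr_gt0.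
have := dist_le_atan (le_n _ As) (le_n _ At).
rewrite -mulrBl normrM normfV ler_pdivrMr// /angle/= => /le_trans; apply.
by rewrite opprD addrACA subrr addr0 (mulrC `|x|) mulrAC.
Qed.

Lemma measurable_angle k : measurable_fun [set: mT * mT] (angle k : mT * mT -> mT).
Proof.
(* the inverse is continuous away from 0, and {0} is measurable *)
have minv : measurable_fun [set: mT] (fun x : mT => x^-1 : mT).
  have -> : [set: mT] = ~` [set 0] `|` [set 0] by rewrite setUC setUv.
  apply/measurable_funU => //; first exact: measurableC.
  split; last exact: measurable_fun_set1.
  apply: open_continuous_measurable_fun.
    by apply: closed_openC; apply: accessible_closed_set1; exact: hausdorff_accessible.
  move=> x; rewrite inE/= => /eqP x0; exact: inv_continuous.
apply: measurable_funD; last exact: measurable_cst.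
apply: measurableT_comp.
  by apply: continuous_measurable_fun => x; exact: continuous_atan.
apply: measurable_funM; first exact: measurable_snd.
by apply: measurableT_comp; [exact: minv|exact: measurable_fst].
Qed.

Lemma tanDpin (k : nat) (s : R) : tan (s + pi *+ k) = tan s.
Proof.
by elim: k => [|k IH]; rewrite ?mulr0n ?addr0// mulrSr addrA tanDpi.
Qed.

Lemma cos_atan_gt0 (u : R) : 0 < cos (atan u).
Proof. by apply: cos_gt0_pihalf; rewrite atan_gtNpi2 atan_ltpi2. Qed.

Lemma sin_atan (u : R) : sin (atan u) = u * cos (atan u).
Proof.
have c0 : cos (atan u) != 0 by rewrite gt_eqF// cos_atan_gt0.
by rewrite -[X in X * _]atanK /tan divfK.
Qed.

Lemma polar_form (x y : R) : x != 0 -> y != 0 ->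
  exists k r, [/\ (k < 3)%N, 0 < r, angle k (x, y) \in `]0, 2 * pi[%R &
    (x, y) = (r * cos (angle k (x, y)), r * sin (angle k (x, y)))].
Proof.
move=> x0 y0.
suff [k [k3 kx kI]] : exists k, [/\ (k < 3)%N, 0 < (-1) ^+ k * x &
    angle k (x, y) \in `]0, 2 * pi[%R].
  have ca := cos_atan_gt0 (y / x).
  have k2 : (-1) ^+ k * (-1) ^+ k = 1 :> R by rewrite -expr2 sqrr_sign.
  exists k, ((-1) ^+ k * x / cos (atan (y / x))); split => //.
    by rewrite divr_gt0.
  rewrite /angle (alternatingn (@cosDpi R)) (alternatingn (@sinDpi R)) sin_atan /=; congr pair.
    transitivity ((-1) ^+ k * (-1) ^+ k * x); first by rewrite k2 mul1r.
    by field; rewrite gt_eqF.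
  transitivity ((-1) ^+ k * (-1) ^+ k * y); first by rewrite k2 mul1r.
  by field; rewrite x0 gt_eqF.
have := pi_gt0 R => pi0.
have := atan_gtNpi2 (y / x); have := atan_ltpi2 (y / x) => h1 h2.
have a0 (u : R) : 0 < u -> 0 < atan u by move=> /lt_atan; rewrite atan0.
have aN (u : R) : u < 0 -> atan u < 0 by move=> /lt_atan; rewrite atan0.
case: (ltgtP x 0) x0 => // xs _.
  exists 1%N; rewrite expr1 mulN1r oppr_gt0; split => //.
  by rewrite /angle in_itv/= mulr1n; apply/andP; split; lra.
case: (ltgtP y 0) y0 => // ys _.
  exists 2%N; rewrite sqrrN expr1n mul1r; split => //.
  have := aN (y / x); rewrite nmulr_rlt0// invr_gt0 => /(_ xs) ?.
  by rewrite /angle in_itv/= mulr2n; apply/andP; split; lra.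
exists 0%N; rewrite expr0 mul1r; split => //.
have := a0 (y / x) (divr_gt0 ys xs) => ?.
by rewrite /angle in_itv/= mulr0n addr0; apply/andP; split; lra.
Qed.

Lemma negligible_of_sections (A : set (mT * mT)) : measurable A ->
  (forall x : mT, x != 0 -> mu.-negligible [set y : mT | A (x, y)]) ->
  mu2.-negligible A.
Proof.
move=> mA H; apply/negligibleP => //.
apply/product_null_sections => //.
exists [set 0]; split => //; first exact: lebesgue_measure_set1.
move=> x /= xA; apply/eqP/negP => /negP x0; apply: xA.
apply: measure_negligible; first exact: measurable_xsection.
by have := H x x0; apply: negligibleS => y /xsectionP.
Qed.

(** A property of almost every angle holds at almost every point of the plane.
    The two coordinate axes are discarded; the positive horizontal one carries
    the angles 0 and [2 * pi], which are not interior to [[0, 2 * pi]]. *)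
Lemma ae_polar_plane (P : R -> Prop) (Q : R * R -> Prop) :
  (forall r t, 0 < r -> t \in `]0, 2 * pi[%R -> P t -> Q (r * cos t, r * sin t)) ->
  {ae mu, forall t, t \in `]0, 2 * pi[%R -> P t} ->
  {ae mu2, forall p : mT * mT, Q p}.
Proof.
move=> PQ [N [mN N0 PN]].
have nN : mu.-negligible N by exists N; split.
have mA k : measurable [set p : mT * mT | N (angle k p)].
  by rewrite -[X in measurable X]setTI; exact: measurable_angle.
have nA k : mu2.-negligible [set p : mT * mT | N (angle k p)].
  by apply: negligible_of_sections => // x x0; exact: negligible_angle_section.
have nX : mu2.-negligible [set p : mT * mT | p.1 = 0].
  apply: negligible_of_sections.
    have -> : [set p : mT * mT | p.1 = 0] = fst @^-1` [set 0] by [].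
    by rewrite -[X in measurable X]setTI; exact: measurable_fst.
  move=> x /eqP x0; rewrite (_ : [set _ | _] = set0); first exact: negligible_set0.
  by apply/seteqP; split.
have nY : mu2.-negligible [set p : mT * mT | p.2 = 0].
  apply: negligible_of_sections.
    have -> : [set p : mT * mT | p.2 = 0] = snd @^-1` [set 0] by [].
    by rewrite -[X in measurable X]setTI; exact: measurable_snd.
  move=> x _; rewrite (_ : [set _ | _] = [set 0])//.
  by exists [set 0]; split => //; exact: lebesgue_measure_set1.
apply: (negligibleS _ (negligibleU (negligibleU nX nY) (negligible_bigcup nA))).
move=> [x y] /= nQ.
have [->|x0] := eqVneq x 0; first by left; left.
have [->|y0] := eqVneq y 0; first by left; right.
right; have [k [r [_ r0 kI xyE]]] := polar_form x0 y0.
exists k => //=; apply: PN => /= H; apply: nQ.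
by rewrite xyE; apply: PQ => //; exact: H.
Qed.

Lemma ae_exists_itv (a b : R) (S : R -> Prop) : a < b ->
  {ae mu, forall x : mT, S x} -> exists2 x, x \in `]a, b[%R & S x.
Proof.
move=> ab [N [mN N0 SN]]; apply: contrapT => H.
have : (mu `]a, b[%classic <= mu N)%E.
  apply: le_measure; [by rewrite inE; exact: measurable_itv|by rewrite inE|].
  by move=> x xab; apply: SN => Sx; apply: H; exists x.
by rewrite N0 lebesgue_measure_itv/= lte_fin ab -EFinB lee_fin; lra.
Qed.

(** Conversely, a property of almost every point of the plane which depends
    only on the angle holds for almost every angle.  It is tested on two vertical
    lines, one on either side of the vertical axis, that meet the exceptional
    set in a null set. *)
Lemma ae_plane_polar (P : R -> Prop) (Q : R * R -> Prop) :
  (forall r t, 0 < r -> t \in `]0, 2 * pi[%R -> Q (r * cos t, r * sin t) -> P t) ->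
  {ae mu2, forall p : mT * mT, Q p} ->
  {ae mu, forall t, t \in `]0, 2 * pi[%R -> P t}.
Proof.
move=> QP [N [mN /(product_null_sections mN) N0 QN]].
have [xp] := ae_exists_itv ltr01 N0; rewrite in_itv/= => /andP[xp0 _] Nxp.
have [xn] := ae_exists_itv (ltrN10 R) N0; rewrite in_itv/= => /andP[_ xn0] Nxn.
(* the line used for the angles that differ from k pi by less than pi / 2 *)
pose x (k : nat) : R := if odd k then xn else xp.
have Nx k : mu.-negligible (xsection N (x k)).
  exists (xsection N (x k)); split => //; first exact: measurable_xsection.
  by rewrite /x; case: ifP.
have kx k : 0 < (-1) ^+ k * x k.
  by rewrite -signr_odd /x; case: odd; rewrite ?expr1 ?expr0 ?mulN1r ?oppr_gt0 ?mul1r.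
pose I k : set R := `](pi *+ k - pi / 2), (pi *+ k + pi / 2)[%classic.
have IE k t : I k t -> exists2 s, s \in `](- (pi / 2)), (pi / 2)[%R & t = s + pi *+ k.
  rewrite /I/= in_itv/= => /andP[t1 t2]; exists (t - pi *+ k); last by rewrite subrK.
  by rewrite in_itv/=; apply/andP; split; lra.
have nI k : mu.-negligible (I k `&` (fun t => x k * tan t) @^-1` (xsection N (x k))).
  have xk0 : 0 < `|x k|.
    by rewrite normr_gt0; apply/eqP => xk; have := kx k; rewrite xk mulr0 ltxx.
  apply: (@negligible_preimage_expanding _ _ _ _ `|x k|^-1) => //.
    by rewrite invr_gt0.
  move=> t t' /IE[s sI ->] /IE[s' s'I ->].
  rewrite !tanDpin -mulrBr normrM mulrA mulVf ?gt_eqF// mul1r.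
  rewrite opprD addrACA subrr addr0 -{1}(tanK sI) -{1}(tanK s'I).
  exact: atan_le_dist.
have n1 (c : R) : mu.-negligible [set c].
  by exists [set c]; split => //; exact: lebesgue_measure_set1.
apply: (negligibleS _ (negligibleU (negligibleU (n1 (pi / 2)) (n1 (3 * pi / 2)))
  (negligible_bigcup nI))).
move=> t /= /not_implyP[tI nPt].
have pi0 := pi_gt0 R.
have [->|t1] := eqVneq t (pi / 2); first by left; left.
have [->|t2] := eqVneq t (3 * pi / 2); first by left; right.
right.
have [k tk] : exists k, I k t.
  move: tI t1 t2; rewrite in_itv/= => /andP[? ?].
  case: (ltgtP t (pi / 2)) => // ? _.
    by exists 0%N; rewrite /I/= in_itv/= mulr0n; apply/andP; split; lra.
  case: (ltgtP t (3 * pi / 2)) => // ? _.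
    by exists 1%N; rewrite /I/= in_itv/= mulr1n; apply/andP; split; lra.
  by exists 2%N; rewrite /I/= in_itv/= mulr2n; apply/andP; split; lra.
exists k => //; split => //=; apply/xsectionP; apply: QN => /= Qt; apply: nPt.
have [s sI tE] := IE _ _ tk.
have cs : 0 < cos s by apply: cos_gt0_pihalf; move: sI; rewrite in_itv.
have xct : 0 < x k / cos t.
  rewrite tE (alternatingn (@cosDpi R)) invfM invr_sign mulrA (mulrC (x k)).
  by rewrite divr_gt0.
have ct : cos t != 0 by apply/eqP => ct; move: xct; rewrite ct invr0 mulr0 ltxx.
apply: (QP _ _ xct tI).
by rewrite divfK// mulrAC -mulrA.
Qed.

End polar.

(** * Chords and arcs of the unit circle *)

Section circle_geometry.
Context {R : realType}.
Local Notation C := (Rcomplex R).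
Implicit Types (a b s t M : R) (z : C).

Lemma Rcomplex_normE z : `|z| = Num.sqrt (complex.Re z ^+ 2 + complex.Im z ^+ 2).
Proof. by case: z. Qed.

Lemma Rcomplex_normr2 z : `|z| ^+ 2 = complex.Re z ^+ 2 + complex.Im z ^+ 2.
Proof. by rewrite Rcomplex_normE sqr_sqrtr// addr_ge0// sqr_ge0. Qed.

Lemma Re_scale a z : complex.Re (a *: z) = a * complex.Re z.
Proof. by case: z. Qed.

Lemma Im_scale a z : complex.Im (a *: z) = a * complex.Im z.
Proof. by case: z. Qed.

Lemma Re_sub z1 z2 : complex.Re (z1 - z2 : C) = complex.Re z1 - complex.Re z2.
Proof. by case: z1; case: z2. Qed.

Lemma Im_sub z1 z2 : complex.Im (z1 - z2 : C) = complex.Im z1 - complex.Im z2.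
Proof. by case: z1; case: z2. Qed.

Lemma cis_circle t : circle (cis t : C).
Proof. by rewrite /circle/= Rcomplex_normE /= cos2Dsin2 sqrtr1. Qed.

Lemma chordE a b : `|cis a - cis b : C| = 2 * `|sin ((a - b) / 2)|.
Proof.
apply/eqP; rewrite -(@eqrXn2 _ 2) ?mulr_ge0//; apply/eqP.
rewrite Rcomplex_normr2 Re_sub Im_sub /cis /= exprMn real_normK ?num_real//.
have -> : a = (a - b) / 2 + (a - b) / 2 + b by field.
set h := (a - b) / 2; rewrite (_ : (h + h + b - b) / 2 = h); last by field.
have := cos2Dsin2 b; have := cos2Dsin2 h.
rewrite !(cosD, sinD); set sh := sin h; set ch := cos h; set sb := sin b; set cb := cos b.
move=> hh hb.
transitivity ((cb ^+ 2 + sb ^+ 2) * ((ch ^+ 2 - sh ^+ 2 - 1) ^+ 2 + 4 * ch ^+ 2 * sh ^+ 2)).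
  ring.
rewrite hb mul1r (_ : ch ^+ 2 = 1 - sh ^+ 2); last by lra.
ring.
Qed.

Lemma normr_sin_le (x : R) : `|sin x| <= `|x|.
Proof.
wlog x0 : x / 0 <= x.
  move=> H; have [/H//|/ltW x0] := leP 0 x.
  by rewrite -normrN -sinN -(normrN x); apply: H; rewrite oppr_ge0.
have [c _] := MVT_segment x0 (fun y _ => is_derive_sin y)
  (continuous_subspaceT (@continuous_sin R)).
by rewrite sin0 !subr0 => ->; rewrite normrM ler_piMl// cos_max.
Qed.

Lemma chord_le_dist a b : `|cis a - cis b : C| <= `|a - b|.
Proof.
rewrite chordE; have := normr_sin_le ((a - b) / 2).
by rewrite normrM (ger0_norm (_ : 0 <= 2^-1))//; lra.
Qed.

Lemma sinB_le_sqr (x : R) : 0 <= x <= pi -> x - x ^+ 2 <= sin x.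
Proof.
move=> /andP[x0 xpi].
have [c] := MVT_segment x0 (fun y _ => is_derive_sin y)
  (continuous_subspaceT (@continuous_sin R)).
rewrite sin0 !subr0 in_itv/= => /andP[c0 cx] ->.
have [d] := MVT_segment c0 (fun y _ => is_derive_cos y)
  (continuous_subspaceT (@continuous_cos R)).
rewrite cos0 subr0 in_itv/= => /andP[d0 dc] cosc.
have : sin d * c <= x by apply: le_trans cx; rewrite ler_piMl// sin_le1.
move=> sdc; have ? : 1 - x <= cos c by lra.
nra.
Qed.

(** The quotient of [sin x] by [x] is nonincreasing on [[0, pi / 2]]. *)
Lemma sin_slope (u v : R) : 0 < u -> u <= v -> v <= pi / 2 ->
  u * sin v <= v * sin u.
Proof.
move=> u0 uv vpi; have := pi_gt0 R => pi0.
have [c] := MVT_segment (ltW u0) (fun y _ => is_derive_sin y)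
  (continuous_subspaceT (@continuous_sin R)).
rewrite sin0 !subr0 in_itv/= => /andP[c0 cu] sinu.
have [d] := MVT_segment uv (fun y _ => is_derive_sin y)
  (continuous_subspaceT (@continuous_sin R)).
rewrite in_itv/= => /andP[ud dv] sinvu.
have cosdc : cos d <= cos c.
  have [cI dI] : c \in `[0, pi]%R /\ d \in `[0, pi]%R.
    by rewrite !in_itv/=; split; apply/andP; split; lra.
  by rewrite leNgt (ltr_cos dI cI) -leNgt; lra.
have sv : sin v = cos c * u + cos d * (v - u) by lra.
have : 0 <= u * (v - u) * (cos c - cos d) by rewrite !mulr_ge0//; lra.
by rewrite sinu sv; lra.
Qed.

(** If [l * b] exceeds [pi / 2], then [sin b >= b / (pi / 2)] already gives
    [l * sin b >= 1]. *)
Lemma sin_le_scale (l a b : R) : 1 <= l -> 0 <= b <= pi / 2 ->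
  0 <= a -> a <= pi -> a <= l * b -> sin a <= l * sin b.
Proof.
move=> l1 /andP[b0 bpi] a0 api alb; have := pi_gt0 R => pi0.
have [b0'|b0'] := eqVneq b 0.
  have -> : a = 0 by move: alb; rewrite b0' mulr0; lra.
  by rewrite b0' sin0 mulr0.
have {}b0 : 0 < b by rewrite lt_neqAle eq_sym b0' b0.
have [lb|lb] := leP (l * b) (pi / 2).
  have sab : sin a <= sin (l * b).
    have [aI lbI] : a \in `[- (pi / 2), pi / 2]%R /\ l * b \in `[- (pi / 2), pi / 2]%R.
      by rewrite !in_itv/=; split; apply/andP; split; nra.
    by rewrite leNgt (ltr_sin lbI aI) -leNgt; lra.
  have := @sin_slope b (l * b) b0 _ lb.
  rewrite ler_peMl ?(ltW b0)// => /(_ isT).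
  by rewrite (mulrC l b) -mulrA ler_pM2l// mulrC => /(le_trans sab).
have := @sin_slope b (pi / 2) b0 bpi (lexx _); rewrite sin_pihalf mulr1 => sb.
apply: (le_trans (sin_le1 a)).
nra.
Qed.

End circle_geometry.

Section turns.
Context {R : realType}.
Local Notation C := (Rcomplex R).
Local Notation I := (@interval02pi R).
Implicit Types (a b s t M : R) (alpha beta : R -> R).

Lemma interval02piP s : I s <-> 0 <= s <= 2 * pi.
Proof. by rewrite /interval02pi/= in_itv/=. Qed.

(** [cis \o alpha] runs exactly once around the circle, counterclockwise and
    possibly stopping, as its parameter runs through [[0, 2 * pi]]. *)
Definition turn alpha :=
  nondecreasing_on 0 (2 * pi) alpha /\ alpha (2 * pi) - alpha 0 = 2 * pi.

Lemma turn_id : turn id.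
Proof. by split => [//|]; rewrite subr0. Qed.

Lemma turn_incr alpha s t : turn alpha -> 0 <= s -> s <= t -> t <= 2 * pi ->
  0 <= alpha t - alpha s <= 2 * pi.
Proof.
move=> [nd tot] s0 st t2; rewrite subr_ge0 nd//= -tot.
have := nd 0 s (lexx _) s0 (le_trans st t2).
by have := nd t (2 * pi) (le_trans s0 st) t2 (lexx _); lra.
Qed.

(** Between the images of [s] and [t] there are two arcs, of lengths
    [B = beta t - beta s] and [2 * pi - B]; the hypothesis applies to both, and
    the sine is compared on the shorter one. *)
Lemma chord_le_of_turn_le alpha beta M : turn alpha -> turn beta ->
  (forall s t, 0 <= s -> s <= t -> t <= 2 * pi ->
    alpha t - alpha s <= M * (beta t - beta s)) ->
  forall s t, I s -> I t ->
    `|cis (alpha s) - cis (alpha t) : C| <= M * `|cis (beta s) - cis (beta t) : C|.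
Proof.
move=> Ta Tb H s t.
wlog st : s t / s <= t.
  move=> W Is It; have [/W|/ltW /W] := leP s t; first exact.
  by rewrite distrC (distrC (cis (beta s))); exact.
move=> /interval02piP/andP[s0 _] /interval02piP/andP[_ t2].
have pi0 := pi_gt0 R.
have t0 := le_trans s0 st; have s2 := le_trans st t2.
have M1 : 1 <= M.
  have := H 0 (2 * pi) (lexx _) (ltW (mulr_gt0 (ltr0Sn R 1) pi0)) (lexx _).
  by rewrite Ta.2 Tb.2 -{1}[2 * pi]mul1r ler_pM2r ?mulr_gt0.
have /andP[A0 A2] := turn_incr Ta s0 st t2.
have /andP[B0 B2] := turn_incr Tb s0 st t2.
have AB := H s t s0 st t2.
have AB' : 2 * pi - (alpha t - alpha s) <= M * (2 * pi - (beta t - beta s)).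
  have H1 := H 0 s (lexx _) s0 s2; have H2 := H t (2 * pi) t0 t2 (lexx _).
  by have := Ta.2; have := Tb.2; nra.
rewrite distrC (distrC (cis (beta s))) !chordE mulrCA ler_pM2l//.
set A := alpha t - alpha s in A0 A2 AB AB' *.
set B := beta t - beta s in B0 B2 AB AB' *.
rewrite !ger0_norm; first last.
- by apply: sin_ge0_pi; apply/andP; split; lra.
- by apply: sin_ge0_pi; apply/andP; split; lra.
have [Bpi|Bpi] := leP B pi.
  by apply: sin_le_scale => //; [apply/andP; split|..]; lra.
have sinpiB x : sin (pi - x) = sin x :> R.
  by rewrite sinB sinpi cospi mul0r sub0r mulN1r opprK.
rewrite -sinpiB -(sinpiB (B / 2)).
by apply: sin_le_scale => //; [apply/andP; split|..]; lra.
Qed.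

(** By induction on [n], cutting [[s, t]] at a point where [alpha] takes the
    mean of its values at the endpoints, the sum of the [2 ^+ n] equal chords
    inscribed in the arc from [alpha s] to [alpha t] is at most
    [M * (beta t - beta s)]; this sum tends to [alpha t - alpha s]. *)
Lemma turn_le_of_chord_le alpha beta M : nondecreasing_on 0 (2 * pi) alpha ->
  alpha (2 * pi) - alpha 0 <= 2 * pi ->
  {within I, continuous alpha} ->
  (forall s t, 0 <= s -> s <= t -> t <= 2 * pi ->
    `|cis (alpha s) - cis (alpha t) : C| <= M * (beta t - beta s)) ->
  forall s t, 0 <= s -> s <= t -> t <= 2 * pi ->
    alpha t - alpha s <= M * (beta t - beta s).
Proof.
move=> nd tot ca H.
have pi0 := pi_gt0 R.
have P (n : nat) : forall s t, 0 <= s -> s <= t -> t <= 2 * pi ->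
    2 ^+ n * (2 * sin ((alpha t - alpha s) / 2 ^+ n.+1)) <= M * (beta t - beta s).
  elim: n => [|n IH] s t s0 st t2.
    rewrite expr0 mul1r expr1; apply: le_trans (H s t s0 st t2).
    by rewrite distrC chordE ler_pM2l// ler_norm.
  have ast := nd s t s0 st t2.
  have [u uI ua] : exists2 u, u \in `[s, t]%R & alpha u = (alpha s + alpha t) / 2.
    apply: IVT => //.
      apply: continuous_subspaceW ca; apply: subset_itv; rewrite bnd_simp//.
    by rewrite ge_min le_max; apply/andP; split; apply/orP; [left|right]; lra.
  move: uI; rewrite in_itv/= => /andP[su ut].
  have H1 := IH s u s0 su (le_trans ut t2).
  have H2 := IH u t (le_trans s0 su) ut t2.
  have E2 : 2 ^+ n.+2 = 2 * 2 ^+ n.+1 :> R by rewrite exprS.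
  have n0 : 2 ^+ n.+1 != 0 :> R by rewrite expf_neq0.
  have e1 : (alpha u - alpha s) / 2 ^+ n.+1 = (alpha t - alpha s) / 2 ^+ n.+2.
    by rewrite ua E2; field.
  have e2 : (alpha t - alpha u) / 2 ^+ n.+1 = (alpha t - alpha s) / 2 ^+ n.+2.
    by rewrite ua E2; field.
  rewrite e1 in H1; rewrite e2 in H2.
  by rewrite [X in X * _]exprS; lra.
move=> s t s0 st t2; apply/ler_addgt0Pr => e e0.
set D := alpha t - alpha s.
have D0 : 0 <= D by rewrite subr_ge0 nd.
have D2 : D <= 2 * pi.
  have := nd 0 s (lexx _) s0 (le_trans st t2).
  by have := nd t (2 * pi) (le_trans s0 st) t2 (lexx _); rewrite /D; lra.
(* the inscribed chords miss the arc by at most D^2 / 2^(n+1) *)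
have [n ne] : exists n : nat, D ^+ 2 / e <= 2 ^+ n.
  exists (Num.bound (D ^+ 2 / e)).
  have De : 0 <= D ^+ 2 / e by rewrite divr_ge0 ?sqr_ge0 ?ltW.
  apply: (le_trans (ltW (archi_boundP De))).
  by rewrite -natrX ler_nat ltnW// ltn_expl.
have n0 : 0 < 2 ^+ n :> R by rewrite exprn_gt0.
have := P n s t s0 st t2; rewrite -/D.
set x := D / 2 ^+ n.+1 => Px.
have xD : D = 2 * 2 ^+ n * x.
  by rewrite /x exprS mulrC divfK// mulf_neq0// gt_eqF.
have x0 : 0 <= x by rewrite divr_ge0// exprn_ge0.
have x1 : x <= pi.
  have : 1 <= 2 ^+ n :> R by rewrite exprn_ege1// ler1n.
  by nra.
have := @sinB_le_sqr R x; rewrite x0 x1 => /(_ isT) sx.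
move: ne; rewrite ler_pdivrMr// => ne.
have : 2 ^+ n * (2 * (x - x ^+ 2)) <= M * (beta t - beta s).
  by apply: le_trans Px; rewrite !ler_pM2l.
suff : 2 * 2 ^+ n * x ^+ 2 <= e by lra.
have e2 : D ^+ 2 = 4 * 2 ^+ n * (2 ^+ n * x ^+ 2) by rewrite xD; ring.
have : 2 ^+ n * (4 * (2 ^+ n * x ^+ 2)) <= 2 ^+ n * e by lra.
by rewrite ler_pM2l//; lra.
Qed.

End turns.

(** * Parametrizations of the circle and radial extensions *)

Section circle_maps.
Context {R : realType}.
Local Notation C := (Rcomplex R).
Local Notation I := (@interval02pi R).
Implicit Types (a b s t M : R) (alpha beta : R -> R).

Lemma cis0_2pi : cis (2 * pi) = cis 0 :> C.
Proof. by rewrite /cis mulrC mulr_natr cos2pi sin2pi cos0 sin0. Qed.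

Lemma cisN_dist a b : `|cis (- a) - cis (- b) : C| = `|cis a - cis b : C|.
Proof.
by rewrite !chordE (_ : (- a - - b) / 2 = - ((a - b) / 2)) ?sinN ?normrN//; field.
Qed.

Lemma cis_inj_lt s t : `|s - t| < 2 * pi -> cis s = cis t :> C -> s = t.
Proof.
wlog st : s t / t <= s.
  move=> H; have [/H//|/ltW /H W st e] := leP t s.
  by apply/esym/W => //; rewrite distrC.
rewrite (ger0_norm (_ : 0 <= s - t)) ?subr_ge0// => st2 e.
have := chordE s t; rewrite e subrr normr0 => /esym/eqP.
rewrite mulf_eq0 pnatr_eq0/= normr_eq0 => /eqP sin0.
have [ts|ts] := ltP t s; last lra.
have : 0 < sin ((s - t) / 2) by apply: sin_gt0_pi; apply/andP; split; lra.
by rewrite sin0 ltxx.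
Qed.

Lemma circle_cis0 (z : C) : circle z -> exists2 t, I t & z = cis t.
Proof.
rewrite /circle/= => z1; have := Rcomplex_normr2 z; rewrite z1 expr1n.
case: z z1 => x y _ /= /esym xy1.
have pi0 := pi_gt0 R.
have x1 : -1 <= x <= 1.
  by rewrite -ler_norml -(@ler_pXn2r _ 2) ?nnegrE// real_normK ?num_real// expr1n; nra.
have xI : x \in `[-1, 1]%R by rewrite in_itv.
have := acos_ge0 x1; have := acos_lepi x1 => ? ?.
have sa : sin (acos x) = `|y|.
  by rewrite sin_acos// -sqrtr_sqr; congr Num.sqrt; lra.
have [y0|y0] := leP 0 y.
  exists (acos x); first by apply/interval02piP; apply/andP; split; lra.
  by rewrite /cis acosK// sa ger0_norm.
exists (2 * pi - acos x); first by apply/interval02piP; apply/andP; split; lra.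
rewrite /cis addrC mulrC mulr_natr cosD2pi sinD2pi cosN sinN acosK// sa.
by rewrite ltr0_norm// opprK.
Qed.

(** An argument of [z] in a prescribed interval of length [2 * pi], obtained by
    rotating [z] by the angle [- a]. *)
Lemma circle_cis a (z : C) : circle z ->
  exists t, [/\ a <= t, t <= a + 2 * pi & z = cis t].
Proof.
rewrite /circle/= => z1; have := Rcomplex_normr2 z; rewrite z1 expr1n.
case: z z1 => x y _ /= /esym xy1.
have := cos2Dsin2 a => h.
pose u : C := ((x * cos a + y * sin a) +i* (y * cos a - x * sin a))%C.
have [|t /interval02piP/andP[t0 t2] ut] := @circle_cis0 u.
  rewrite /circle/= Rcomplex_normE /= (_ : _ + _ = 1) ?sqrtr1//.
  transitivity ((x ^+ 2 + y ^+ 2) * (cos a ^+ 2 + sin a ^+ 2)); first ring.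
  by rewrite h xy1 mulr1.
exists (t + a); split; [lra..|].
move: ut; rewrite /u /cis => -[e1 e2].
rewrite cosD sinD -e1 -e2; congr (_ +i* _)%C.
  transitivity (x * (cos a ^+ 2 + sin a ^+ 2)); [by rewrite h mulr1|ring].
transitivity (y * (cos a ^+ 2 + sin a ^+ 2)); [by rewrite h mulr1|ring].
Qed.

Lemma turn_cis_surj alpha (z : C) : turn alpha -> {within I, continuous alpha} ->
  circle z -> exists2 t, I t & z = cis (alpha t).
Proof.
move=> [nd tot] ca /(@circle_cis (alpha 0))[t [t0 t2 ->]].
have pi0 := pi_gt0 R.
have [||u uI <-] := @IVT R alpha 0 (2 * pi) t _ ca.
- lra.
- by rewrite ge_min le_max t0 /=; apply/orP; right; lra.
- by exists u.
Qed.

(** The decreasing case follows by complex conjugation. *)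
Lemma turnN_cis_surj alpha (z : C) : turn (\- alpha) ->
  {within I, continuous alpha} -> circle z -> exists2 t, I t & z = cis (alpha t).
Proof.
move=> T ca; case: z => x y zc.
have [||t It [e1 e2]] := @turn_cis_surj (\- alpha) (x +i* (- y))%C T.
- by move=> t; apply: continuousN; exact: ca.
- by move: zc; rewrite /circle/= !Rcomplex_normE /= sqrrN.
exists t => //; rewrite /cis.
by move: e1 e2; rewrite /= cosN sinN => -> /oppr_inj ->.
Qed.

(** Since [M >= 1], a comparison of chords extends to points at different
    distances from the origin. *)
Lemma radial_dist M r s (a b c d : C) : 1 <= M -> 0 <= r -> 0 <= s ->
  circle a -> circle b -> circle c -> circle d ->
  `|a - b| <= M * `|c - d| -> `|r *: a - s *: b| <= M * `|r *: c - s *: d|.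
Proof.
move=> M1 r0 s0 ca cb cc cd abcd.
have E (u v : C) : circle u -> circle v ->
    `|r *: u - s *: v| ^+ 2 = (r - s) ^+ 2 + r * s * `|u - v| ^+ 2.
  rewrite /circle/= => u1 v1.
  have := Rcomplex_normr2 u; have := Rcomplex_normr2 v; rewrite u1 v1 expr1n.
  rewrite !Rcomplex_normr2 !Re_sub !Im_sub !Re_scale !Im_scale.
  set x := complex.Re u; set y := complex.Im u.
  set x' := complex.Re v; set y' := complex.Im v => hv hu.
  transitivity (r ^+ 2 * (x ^+ 2 + y ^+ 2) + s ^+ 2 * (x' ^+ 2 + y' ^+ 2) -
    2 * r * s * (x * x' + y * y')); first ring.
  rewrite -hv -hu.
  transitivity ((r - s) ^+ 2 + r * s * ((x ^+ 2 + y ^+ 2) + (x' ^+ 2 + y' ^+ 2)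
    - 2 * (x * x' + y * y'))); last ring.
  by rewrite -hv -hu; ring.
rewrite -(@ler_pXn2r _ 2) ?nnegrE ?mulr_ge0//; last lra.
rewrite exprMn !E//.
have : `|a - b| ^+ 2 <= (M * `|c - d|) ^+ 2.
  by rewrite ler_pXn2r ?nnegrE ?mulr_ge0//; lra.
rewrite exprMn => h.
have rs0 : 0 <= r * s by rewrite mulr_ge0.
have : r * s * `|a - b| ^+ 2 <= r * s * (M ^+ 2 * `|c - d| ^+ 2) by rewrite ler_wpM2l.
have : (r - s) ^+ 2 <= M ^+ 2 * (r - s) ^+ 2.
  by rewrite ler_peMl ?sqr_ge0// exprn_ege1.
by lra.
Qed.

Lemma unit_circle (z : C) : z != 0 -> circle (`|z|^-1 *: z).
Proof.
by move=> z0; rewrite /circle/= normrZ normfV normr_id mulVf// normr_eq0.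
Qed.

Lemma normr_scale_unit (z : C) : z != 0 -> z = `|z| *: (`|z|^-1 *: z).
Proof. by move=> z0; rewrite scalerA divff ?scale1r// normr_eq0. Qed.

Lemma radial_polar (F : C -> C) r (v : C) : 0 < r -> circle v ->
  radial F (r *: v) = r *: F v.
Proof.
rewrite /circle/= => r0 v1.
have v0 : v != 0 by rewrite -normr_eq0 v1 oner_neq0.
rewrite /radial scaler_eq0 (negbTE v0) (gt_eqF r0) orbF/=.
by rewrite normrZ v1 mulr1 gtr0_norm// scalerA mulVf ?scale1r// gt_eqF.
Qed.

Lemma radial0 (F : C -> C) : radial F 0 = 0.
Proof. by rewrite /radial eqxx. Qed.

End circle_maps.

(** * Bi-Lipschitz self-maps of the circle and their lifts *)

Section bilipschitz_circle_maps.
Context {R : realType}.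
Local Notation C := (Rcomplex R).
Local Notation I := (@interval02pi R).
Implicit Types (s t M : R) (alpha beta : R -> R) (z : C).

Lemma turn_le_normP alpha beta M : turn alpha -> turn beta ->
  (forall s t, 0 <= s -> s <= t -> t <= 2 * pi ->
    alpha t - alpha s <= M * (beta t - beta s)) <->
  (forall s t, I s -> I t -> `|alpha s - alpha t| <= M * `|beta s - beta t|).
Proof.
move=> [nda _] [ndb _]; split=> H s t.
  wlog st : s t / s <= t.
    move=> W Is It; have [/W|/ltW /W] := leP s t; first exact.
    by rewrite distrC (distrC (beta s)); exact.
  move=> /interval02piP/andP[s0 _] /interval02piP/andP[_ t2].
  rewrite distrC (distrC (beta s)) !ger0_norm ?subr_ge0 ?nda ?ndb//.
  exact: H.
move=> s0 st t2; have := H s t.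
rewrite distrC (distrC (beta s)) !ger0_norm ?subr_ge0 ?nda ?ndb//; apply.
  by apply/interval02piP; rewrite s0 (le_trans st).
by apply/interval02piP; rewrite t2 (le_trans s0).
Qed.

Variables (F : C -> C) (psi : R -> R).
Hypothesis F_circle : forall z, circle z -> circle (F z).
Hypothesis F_bilip : bilipschitz_on circle F.
Hypothesis psi_continuous : {within I, continuous psi}.
Hypothesis psi_lift : forall x, I x -> F (cis x) = cis (psi x).

Lemma F_inj z1 z2 : circle z1 -> circle z2 -> F z1 = F z2 -> z1 = z2.
Proof.
move=> c1 c2 e; have [l [L [l0 _ /(_ _ _ c1 c2)/andP[+ _]]]] := F_bilip.
rewrite e subrr normr0 pmulr_rle0// normr_le0 subr_eq0 => /eqP//.
Qed.

Lemma psi_eq s t : I s -> I t -> `|s - t| < 2 * pi ->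
  cis (psi s) = cis (psi t) :> C -> s = t.
Proof.
move=> Is It st; rewrite -!psi_lift// => /F_inj h.
by apply: cis_inj_lt => //; apply: h; exact: cis_circle.
Qed.

Lemma psi_inj : {in `[0, 2 * pi]%R &, injective psi}.
Proof.
have pi0 := pi_gt0 R.
have ends : psi 0 <> psi (2 * pi).
  (* otherwise psi takes the value v both before and after pi *)
  move=> e0; pose v := (psi 0 + psi pi) / 2.
  have I0 : I 0 by apply/interval02piP; lra.
  have Ipi : I pi by apply/interval02piP; lra.
  have [||x] := @IVT R psi 0 pi v (ltW pi0).
  - by apply: continuous_subspaceW psi_continuous; apply: subset_itv; rewrite bnd_simp//; lra.
  - rewrite /v ge_min le_max; have [] := leP (psi 0) (psi pi) => ?;
      apply/andP; split; apply/orP; (by left; lra) || (by right; lra).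
  rewrite in_itv/= => /andP[x0 x1] xv.
  have [|||y] := @IVT R psi pi (2 * pi) v.
  - lra.
  - by apply: continuous_subspaceW psi_continuous; apply: subset_itv; rewrite bnd_simp//; lra.
  - rewrite -e0 /v ge_min le_max; have [] := leP (psi 0) (psi pi) => ?;
      apply/andP; split; apply/orP; (by left; lra) || (by right; lra).
  rewrite in_itv/= => /andP[y0 y1] yv.
  have Ix : I x by apply/interval02piP; lra.
  have Iy : I y by apply/interval02piP; lra.
  have [pi_v|pi_v] := eqVneq (psi 0) (psi pi).
    have : 0 = pi :> R by apply: psi_eq; rewrite ?pi_v// sub0r normrN ger0_norm; lra.
    lra.
  have xy : x = y.
    apply: psi_eq; rewrite ?xv ?yv// distrC ger0_norm ?subr_ge0; last lra.
    have [xn0|xn0] := eqVneq x 0.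
      by move: pi_v; rewrite (_ : psi 0 = psi pi) ?eqxx//; move: xv; rewrite xn0 /v; lra.
    by have : 0 < x by [rewrite lt_neqAle eq_sym xn0]; lra.
  have xpi : x = pi by lra.
  by move: pi_v; rewrite (_ : psi 0 = psi pi) ?eqxx//; move: xv; rewrite xpi /v; lra.
move=> s t; wlog st : s t / s <= t.
  move=> H sI tI e; have [/H|/ltW /H h] := leP s t; first exact.
  by apply/esym; exact: h.
rewrite !in_itv/= => /andP[s0 s2] /andP[t0 t2] e.
have [|d2] := ltP (t - s) (2 * pi).
  move=> d2; apply: psi_eq; rewrite ?e//; try by apply/interval02piP; lra.
  by rewrite distrC ger0_norm ?subr_ge0.
have s0' : s = 0 by lra.
have t2' : t = 2 * pi by lra.
by move: e; rewrite s0' t2' => /ends.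
Qed.

(** The total increment is at least [2 * pi] because the curve closes up, and
    at most [2 * pi] because it does not close up earlier. *)
Lemma total_increment alpha : {within I, continuous alpha} ->
  (forall s t, I s -> I t -> `|s - t| < 2 * pi ->
    cis (alpha s) = cis (alpha t) :> C -> s = t) ->
  cis (alpha 0) = cis (alpha (2 * pi)) :> C ->
  {in `[0, 2 * pi]%R &, injective alpha} -> alpha 0 <= alpha (2 * pi) ->
  alpha (2 * pi) - alpha 0 = 2 * pi.
Proof.
move=> ca cinj closed inj le02; have pi0 := pi_gt0 R.
have I0 : (0 : R) \in `[0, 2 * pi]%R by rewrite in_itv/=; apply/andP; split; lra.
have I2 : (2 * pi : R) \in `[0, 2 * pi]%R by rewrite in_itv/=; apply/andP; split; lra.
apply/eqP; rewrite eq_le !leNgt; apply/andP; split; apply/negP => h.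
- have [||u] := @IVT R alpha 0 (2 * pi) (alpha 0 + 2 * pi) _ ca; first lra.
    by rewrite ge_min le_max; apply/andP; split; apply/orP; [left|right]; lra.
  move=> uI uE.
  have u0 : u = 0.
    apply: cinj; [exact: uI|exact: I0| |].
      have /interval02piP/andP[u0 u2] : I u := uI.
      rewrite subr0.
      rewrite ger0_norm// lt_neqAle u2 andbT; apply/eqP => u2'.
      by move: uE; rewrite u2'; lra.
    by rewrite uE /cis mulrC mulr_natr cosD2pi sinD2pi.
  by move: uE; rewrite u0; lra.
- have /inj e : alpha 0 = alpha (2 * pi).
    by apply: cis_inj_lt => //; rewrite distrC ger0_norm; lra.
  by have := e I0 I2; lra.
Qed.

Lemma psi_turn : turn psi \/ turn (\- psi).
Proof.
have pi0 := pi_gt0 R.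
have closed : cis (psi 0) = cis (psi (2 * pi)) :> C.
  by rewrite -!psi_lift ?cis0_2pi//; apply/interval02piP; lra.
have mem x : 0 <= x -> x <= 2 * pi -> x \in `[0, 2 * pi]%R.
  by move=> ? ?; rewrite in_itv/=; apply/andP.
have [le02|/ltW le20] := leP (psi 0) (psi (2 * pi)); [left|right]; split.
- move=> x y x0 xy y2.
  rewrite (segment_continuous_inj_le le02 psi_continuous psi_inj)//; apply: mem; lra.
- by apply: total_increment => //; [exact: psi_eq|exact: psi_inj].
- move=> x y x0 xy y2; rewrite lerN2.
  rewrite (segment_continuous_inj_ge le20 psi_continuous psi_inj)//; apply: mem; lra.
- apply: total_increment => //.
  + by move=> t; apply: continuousN; exact: psi_continuous.
  + move=> s t Is It st e; apply: psi_eq => //; apply/eqP.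
    by rewrite -subr_eq0 -normr_eq0 -cisN_dist e subrr normr0.
  + by apply/eqP; rewrite -subr_eq0 -normr_eq0 cisN_dist closed subrr normr0.
  + by move=> x y xI yI /oppr_inj; exact: psi_inj.
  + by rewrite lerN2.
Qed.

(** A decreasing lift is replaced by its opposite, which changes neither the
    absolute increments nor the chords. *)
Lemma psi_reoriented : exists alpha, [/\ turn alpha, {within I, continuous alpha},
  forall s t, `|alpha s - alpha t| = `|psi s - psi t| &
  forall s t, `|cis (alpha s) - cis (alpha t) : C| = `|cis (psi s) - cis (psi t) : C|].
Proof.
have [T|T] := psi_turn; first by exists psi.
exists (\- psi); split => //=.
- by move=> t; apply: continuousN; exact: psi_continuous.
- by move=> s t; rewrite -opprB normrN opprK addrC.
- by move=> s t; exact: cisN_dist.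
Qed.

Lemma F_surj z : circle z -> exists2 z', circle z' & F z' = z.
Proof.
move=> cz; have [t It ->] : exists2 t, I t & z = cis (psi t).
  by case: psi_turn => T; [exact: turn_cis_surj|exact: turnN_cis_surj].
by exists (cis t); [exact: cis_circle|exact: psi_lift].
Qed.

(** [lip_psi_of_f] and [lip_F_of_psi] compare Lipschitz constants;
    [expand_psi_of_F] and [expand_F_of_psi] do the same for the inverses, with
    the roles of [psi] and of the identity exchanged. *)
Lemma lip_psi_of_f M :
  (forall s t, I s -> I t -> `|F (cis s) - F (cis t)| <= M * `|s - t|) ->
  forall s t, I s -> I t -> `|psi s - psi t| <= M * `|s - t|.
Proof.
have [alpha [Ta ca absE cisE]] := psi_reoriented => H s t Is It.
rewrite -absE; apply: ((turn_le_normP M Ta turn_id).1 _ s t Is It).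
apply: turn_le_of_chord_le => //; [exact: Ta.1|by rewrite Ta.2|].
move=> {Is It} {}s {}t s0 st t2; rewrite cisE.
have Is : I s by apply/interval02piP; lra.
have It : I t by apply/interval02piP; lra.
by rewrite -!psi_lift// -(ger0_norm (_ : 0 <= t - s)) ?subr_ge0// distrC H.
Qed.

Lemma lip_ge1 M :
  (forall s t, I s -> I t -> `|psi s - psi t| <= M * `|s - t|) -> 1 <= M.
Proof.
have [alpha [Ta ca absE cisE]] := psi_reoriented => H; have pi0 := pi_gt0 R.
have := H (2 * pi) 0; rewrite -absE Ta.2 subr0 ger0_norm; last lra.
rewrite -[X in X <= _]mul1r ler_pM2r; last lra.
by apply; apply/interval02piP; lra.
Qed.

Lemma lip_F_of_psi M :
  (forall s t, I s -> I t -> `|psi s - psi t| <= M * `|s - t|) ->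
  forall z1 z2, circle z1 -> circle z2 -> `|F z1 - F z2| <= M * `|z1 - z2|.
Proof.
have [alpha [Ta ca absE cisE]] := psi_reoriented => H z1 z2.
move=> /circle_cis0[s Is ->] /circle_cis0[t It ->].
rewrite !psi_lift// -cisE; apply: (chord_le_of_turn_le Ta turn_id) => //.
by apply/(turn_le_normP M Ta turn_id) => ? ? ? ?; rewrite absE; exact: H.
Qed.

Lemma expand_ge1 M :
  (forall s t, I s -> I t -> `|s - t| <= M * `|psi s - psi t|) -> 1 <= M.
Proof.
have [alpha [Ta ca absE cisE]] := psi_reoriented => H; have pi0 := pi_gt0 R.
have := H (2 * pi) 0; rewrite -absE Ta.2 subr0 ger0_norm; last lra.
rewrite -[X in X <= _]mul1r ler_pM2r; last lra.
by apply; apply/interval02piP; lra.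
Qed.

Lemma expand_psi_of_F M :
  (forall z1 z2, circle z1 -> circle z2 -> `|z1 - z2| <= M * `|F z1 - F z2|) ->
  forall s t, I s -> I t -> `|s - t| <= M * `|psi s - psi t|.
Proof.
have [alpha [Ta ca absE cisE]] := psi_reoriented => H s t Is It.
have pi0 := pi_gt0 R.
have M0 : 0 <= M.
  have := H (cis 0) (cis pi) (cis_circle _) (cis_circle _).
  rewrite leNgt; apply: contraNle => Mlt0.
  apply: (@le_lt_trans _ _ 0); first by rewrite nmulr_rle0.
  rewrite normr_gt0 subr_eq0; apply/eqP => /cis_inj_lt.
  by rewrite sub0r normrN ger0_norm; lra.
rewrite -absE; apply: ((turn_le_normP M turn_id Ta).1 _ s t Is It).
apply: turn_le_of_chord_le => //; [by rewrite subr0| |].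
  by apply: continuous_subspaceT => x; exact: cvg_id.
move=> {Is It} {}s {}t s0 st t2.
have Is : I s by apply/interval02piP; lra.
have It : I t by apply/interval02piP; lra.
apply: (le_trans (H _ _ (cis_circle _) (cis_circle _))).
rewrite !psi_lift// -cisE ler_wpM2l// (le_trans (chord_le_dist _ _))//.
by rewrite distrC ger0_norm// subr_ge0 Ta.1.
Qed.

Lemma expand_F_of_psi M :
  (forall s t, I s -> I t -> `|s - t| <= M * `|psi s - psi t|) ->
  forall z1 z2, circle z1 -> circle z2 -> `|z1 - z2| <= M * `|F z1 - F z2|.
Proof.
have [alpha [Ta ca absE cisE]] := psi_reoriented => H z1 z2.
move=> /circle_cis0[s Is ->] /circle_cis0[t It ->].
rewrite !psi_lift// -cisE; apply: (chord_le_of_turn_le turn_id Ta) => //.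
by apply/(turn_le_normP M turn_id Ta) => ? ? ? ?; rewrite absE; exact: H.
Qed.

Lemma radial_norm z : `|radial F z| = `|z|.
Proof.
have [->|z0] := eqVneq z 0; first by rewrite radial0 normr0.
have r0 : 0 < `|z| by rewrite normr_gt0.
have cu := unit_circle z0.
rewrite {1}(normr_scale_unit z0) radial_polar// normrZ normr_id.
by have := F_circle cu; rewrite /circle/= => ->; rewrite mulr1.
Qed.

Lemma lip_radial M : 1 <= M ->
  (forall z1 z2, circle z1 -> circle z2 -> `|F z1 - F z2| <= M * `|z1 - z2|) ->
  forall z1 z2, `|radial F z1 - radial F z2| <= M * `|z1 - z2|.
Proof.
move=> M1 H z1 z2.
have [->|z10] := eqVneq z1 0.
  by rewrite radial0 !sub0r !normrN radial_norm ler_peMl.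
have [->|z20] := eqVneq z2 0; first by rewrite radial0 !subr0 radial_norm ler_peMl.
have c1 := unit_circle z10; have c2 := unit_circle z20.
rewrite (normr_scale_unit z10) (normr_scale_unit z20) !radial_polar ?normr_gt0//.
by apply: radial_dist => //; [exact: F_circle|exact: F_circle|exact: H].
Qed.

Lemma expand_radial M : 1 <= M ->
  (forall z1 z2, circle z1 -> circle z2 -> `|z1 - z2| <= M * `|F z1 - F z2|) ->
  forall z1 z2, `|z1 - z2| <= M * `|radial F z1 - radial F z2|.
Proof.
move=> M1 H z1 z2.
have [->|z10] := eqVneq z1 0.
  by rewrite radial0 !sub0r !normrN radial_norm ler_peMl.
have [->|z20] := eqVneq z2 0; first by rewrite radial0 !subr0 radial_norm ler_peMl.
have c1 := unit_circle z10; have c2 := unit_circle z20.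
rewrite (normr_scale_unit z10) (normr_scale_unit z20) !radial_polar ?normr_gt0//.
by apply: radial_dist => //; [exact: F_circle|exact: F_circle|exact: H].
Qed.

Lemma radial_circle z : circle z -> radial F z = F z.
Proof. by move=> cz; rewrite -[z in LHS]scale1r radial_polar// scale1r. Qed.

Lemma radial_inj : injective (radial F).
Proof.
move=> z1 z2 e; have n12 : `|z1| = `|z2| by rewrite -radial_norm e radial_norm.
have [z10|z10] := eqVneq z1 0.
  by apply/esym/eqP; rewrite z10 -normr_eq0 -n12 z10 normr0.
have z20 : z2 != 0 by rewrite -normr_eq0 -n12 normr_eq0.
have c1 := unit_circle z10; have c2 := unit_circle z20.
move: e; rewrite (normr_scale_unit z10) (normr_scale_unit z20) !radial_polar ?normr_gt0//.
rewrite n12 => /scalerI; rewrite normr_eq0 => /(_ z20) /F_inj.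
by rewrite -{1}n12 => ->.
Qed.

Lemma radial_surj z : exists z', radial F z' = z.
Proof.
have [->|z0] := eqVneq z 0; first by exists 0; rewrite radial0.
have [v cv vE] := F_surj (unit_circle z0).
exists (`|z| *: v); rewrite radial_polar ?normr_gt0// vE -normr_scale_unit//.
Qed.

End bilipschitz_circle_maps.

(** * The differential of the radial extension *)

Section differential.
Context {R : realType}.
Local Notation C := (Rcomplex R).
Local Notation I := (@interval02pi R).
Implicit Types (s t q r d phi : R) (h z : C).

Lemma is_derive_linear_bound (g : R -> R) (g' : R) (e : R) :
  is_derive (0 : R) 1 g g' -> 0 < e ->
  \forall q \near (0 : R), `|g q - g 0 - g' * q| <= e * `|q|.
Proof.
move=> [dg gE] e0.
have : h^-1 *: (g (h + 0) - g 0) @[h --> 0^'] --> g'.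
  rewrite -gE; have := dg; rewrite /derivable /derive.
  by under eq_fun do rewrite /= [_ *: 1]mulr1.
move=> /cvgr_dist_le /(_ _ e0) [dl /= dl0 H].
exists dl => //= q qdl; have [->|q0] := eqVneq q 0.
  by rewrite subrr mulr0 subrr !normr0 mulr0.
have := H q qdl q0; rewrite /= addr0 => Hq.
rewrite (_ : _ - _ = - ((g' - q^-1 * (g q - g 0)) * q)); last by field.
by rewrite normrN normrM ler_wpM2r.
Qed.

(** The coordinates of [h] in the orthonormal basis formed by the radial
    direction [cis t] and the tangential direction [perp t]. *)
Definition along t h : R := complex.Re h * cos t + complex.Im h * sin t.
Definition across t h : R := complex.Im h * cos t - complex.Re h * sin t.

(** The real-linear map sending [cis t] to [cis phi] and [perp t] to
    [d *: perp phi]. *)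
Definition polar_diff t phi d h : C :=
  ((along t h * cos phi - d * across t h * sin phi) +i*
   (along t h * sin phi + d * across t h * cos phi))%C.

Lemma along_across t h : along t h ^+ 2 + across t h ^+ 2 = `|h| ^+ 2.
Proof.
rewrite Rcomplex_normr2 /along /across; set x := complex.Re h; set y := complex.Im h.
transitivity ((x ^+ 2 + y ^+ 2) * (cos t ^+ 2 + sin t ^+ 2)); first ring.
by rewrite cos2Dsin2 mulr1.
Qed.

Lemma normr_along t h : `|along t h| <= `|h|.
Proof.
rewrite -(@ler_pXn2r _ 2) ?nnegrE// real_normK ?num_real// -(along_across t).
by rewrite lerDl sqr_ge0.
Qed.

Lemma normr_across t h : `|across t h| <= `|h|.
Proof.
rewrite -(@ler_pXn2r _ 2) ?nnegrE// real_normK ?num_real// -(along_across t).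
by rewrite lerDr sqr_ge0.
Qed.

Lemma polar_diff_linear t phi d : linear (polar_diff t phi d).
Proof.
move=> a [x1 y1] [x2 y2]; rewrite /polar_diff /along /across /=.
apply/eqP; rewrite eq_complex/=; apply/andP; split; apply/eqP; ring.
Qed.

HB.instance Definition _ t phi d := GRing.isLinear.Build R C C _
  (polar_diff t phi d) (polar_diff_linear t phi d).

Lemma normr_polar_diff t phi d h :
  `|polar_diff t phi d h| ^+ 2 = along t h ^+ 2 + d ^+ 2 * across t h ^+ 2.
Proof.
rewrite Rcomplex_normr2 /polar_diff /=; set a := along t h; set b := across t h.
transitivity ((a ^+ 2 + d ^+ 2 * b ^+ 2) * (cos phi ^+ 2 + sin phi ^+ 2)); first ring.
by rewrite cos2Dsin2 mulr1.
Qed.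

Lemma polar_diff_continuous t phi d : continuous (polar_diff t phi d).
Proof.
apply: bounded_linear_continuous; apply/linear_boundedP.
exists (1 + `|d|); split; first exact: num_real.
move=> r /= dr h; apply: (@le_trans _ _ ((1 + `|d|) * `|h|)); last first.
  by rewrite ler_wpM2r// ltW.
have d0 := normr_ge0 d; have h0 := normr_ge0 h.
rewrite -(@ler_pXn2r _ 2) ?nnegrE ?mulr_ge0 ?addr_ge0//.
rewrite normr_polar_diff exprMn -(along_across t) -(real_normK (num_real d)).
have := sqr_ge0 (along t h); have := sqr_ge0 (across t h).
set a := along t h ^+ 2; set b := across t h ^+ 2; move=> b0 a0.
have ad : 0 <= a * `|d| by rewrite mulr_ge0.
have bd : 0 <= b * `|d| by rewrite mulr_ge0.
have ad2 : 0 <= b * `|d| ^+ 2 by rewrite mulr_ge0 ?sqr_ge0.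
have ad3 : 0 <= a * `|d| ^+ 2 by rewrite mulr_ge0 ?sqr_ge0.
lra.
Qed.

Variables (F : C -> C) (psi : R -> R).
Hypothesis psi_lift : forall x, I x -> F (cis x) = cis (psi x).

(** For [g] the cosine or the sine, this is a coordinate of the radial extension
    along the line tangent to the circle at [cis t], since the point of that line
    at distance [q] from [cis t] has modulus [(cos (atan q))^-1] and argument
    [t + atan q]. *)
Lemma transversal_derive t d (g : R -> R) (g' : R) :
  is_derive t 1 psi d -> is_derive (psi t) 1 g g' ->
  is_derive (0 : R) 1 (fun q => g (psi (t + atan q)) / cos (atan q)) (g' * d).
Proof.
move=> dpsi dg.
have da : is_derive (0 : R) 1 (fun q => t + atan q) 1.
  apply: (is_derive_eq (is_deriveD (is_derive_cst t (0 : R) (1 : R)) (is_derive1_atan 0))).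
  by rewrite expr0n addr0 invr1 add0r.
have dpsi0 : is_derive (t + atan 0) 1 psi d by rewrite atan0 addr0.
have dg0 : is_derive (psi (t + atan 0)) 1 g g' by rewrite atan0 addr0.
have d1 : is_derive (0 : R) 1 (fun q => g (psi (t + atan q))) (g' * d).
  have := @is_derive1_comp R g _ 0 _ _ dg0 (@is_derive1_comp R psi _ 0 _ _ dpsi0 da).
  by rewrite mulr1.
have d2 : is_derive (0 : R) 1 (fun q => cos (atan q)) 0.
  apply: (is_derive_eq (is_derive1_comp (is_derive_cos _) (is_derive1_atan 0))).
  by rewrite atan0 sin0 oppr0 mul0r.
have c0 : cos (atan 0) != 0 :> R by rewrite atan0 cos0 oner_neq0.
apply: (is_derive_eq (is_deriveM d1 (is_deriveV c0 d2))).
by rewrite scaler0 scaler0 add0r atan0 cos0 invr1 scale1r.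
Qed.

(** [r *: cis t + h] is [r + along t h] times the point [cis t + q *: perp t]
    of the line tangent to the circle at [cis t]. *)
Lemma radial_polar_near t r h : 0 < r -> I (t + atan (across t h / (r + along t h))) ->
  0 < r + along t h ->
  let q := across t h / (r + along t h) in
  radial F (r *: cis t + h) = (r + along t h) *:
    (((cos (psi (t + atan q)) / cos (atan q)) +i* (sin (psi (t + atan q)) / cos (atan q)))%C : C).
Proof.
move=> r0 It p0 q.
have c0 := cos_atan_gt0 q.
have -> : r *: cis t + h = ((r + along t h) / cos (atan q)) *: cis (t + atan q) :> C.
  have h1 : (r + along t h) / cos (atan q) * cos (t + atan q) =
      (r + along t h) * cos t - across t h * sin t.
    rewrite cosD sin_atan /q; field; rewrite !gt_eqF//.
  have h2 : (r + along t h) / cos (atan q) * sin (t + atan q) =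
      (r + along t h) * sin t + across t h * cos t.
    rewrite sinD sin_atan /q; field; rewrite !gt_eqF//.
  apply/eqP; rewrite eq_complex Re_scale Im_scale [complex.Re (cis _)]/=.
  rewrite [complex.Im (cis _)]/= h1 h2.
  move: {h1 h2 It p0} q c0; rewrite /along /across; case: h => x y /= _ _.
  have e := cos2Dsin2 t; apply/andP; split; apply/eqP.
    transitivity (r * cos t + x * (cos t ^+ 2 + sin t ^+ 2)); [by rewrite e mulr1|ring].
  transitivity (r * sin t + y * (cos t ^+ 2 + sin t ^+ 2)); [by rewrite e mulr1|ring].
rewrite radial_polar ?divr_gt0//; last exact: cis_circle.
rewrite psi_lift// -scalerA; congr (_ *: _).
by apply/eqP; rewrite eq_complex Re_scale Im_scale /=; apply/andP; split; rewrite mulrC.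
Qed.

Lemma Rcomplex_normr_le h : `|h| <= `|complex.Re h| + `|complex.Im h|.
Proof.
rewrite -(@ler_pXn2r _ 2) ?nnegrE ?addr_ge0// Rcomplex_normr2.
rewrite -(real_normK (num_real (complex.Re h))) -(real_normK (num_real (complex.Im h))).
have := mulr_ge0 (normr_ge0 (complex.Re h)) (normr_ge0 (complex.Im h)); lra.
Qed.

(** With [q] as in [radial_polar_near] and [g] the restriction of the radial
    extension to the tangent line, parametrized by [q], the increment of the
    radial extension differs from [polar_diff] exactly by
    [(r + along t h) *: (g q - g 0 - q *: g' 0)].  As [(r + along t h) * q] is
    [across t h], this is negligible before [h] by the differentiability of the
    single-variable function [g] at 0. *)
Lemma radial_diff t r d : 0 < r -> 0 < t < 2 * pi -> is_derive t 1 psi d ->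
  'd (radial F) (r *: cis t : C) = polar_diff t (psi t) d :> (C -> C).
Proof.
move=> r0 /andP[t0 t2] dpsi.
apply: diff_unique; first exact: polar_diff_continuous.
apply/eqaddoP => e e0.
have e2 : 0 < e / 2 by rewrite divr_gt0.
have Dc := is_derive_linear_bound (transversal_derive dpsi (is_derive_cos (psi t))) e2.
have Ds := is_derive_linear_bound (transversal_derive dpsi (is_derive_sin (psi t))) e2.
have It : {near (0 : R), forall q, I (t + atan q)}.
  have : atan q @[q --> (0:R)] --> (0:R).
    by rewrite -[X in _ --> X](@atan0 R); exact: continuous_atan.
  move=> ca.
  have ca' : t + atan q @[q --> (0:R)] --> t.
    by rewrite -[X in _ --> X]addr0; apply: cvgD => //; exact: cvg_cst.
  have tI : t \in `]0, 2 * pi[%R by rewrite in_itv/= t0.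
  have hI : \forall q \near (0:R), t + atan q \in `]0, 2 * pi[%R.
    exact: (ca' _ (near_in_itvoo tI)).
  move: hI; apply: filterS => q.
  by rewrite in_itv/= => /andP[? ?]; apply/interval02piP; lra.
have [dl /= dl0 H] : \forall q \near (0:R), [/\ I (t + atan q),
   `|cos (psi (t + atan q)) / cos (atan q) - cos (psi t) - - sin (psi t) * d * q| <= e / 2 * `|q| &
   `|sin (psi (t + atan q)) / cos (atan q) - sin (psi t) - cos (psi t) * d * q| <= e / 2 * `|q|].
  move: Dc Ds It; rewrite /= !atan0 !addr0 cos0 !divr1 => Dc Ds It.
  by near=> q; split; near: q.
have m0 : 0 < dl * r / 4 by rewrite divr_gt0// mulr_gt0.
near=> h.
have hr : `|h| < r / 2 by near: h; apply: nbhs0_lt; rewrite divr_gt0.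
have hdl : `|h| < dl * r / 4 by near: h; exact: nbhs0_lt.
have /andP[a1 a2] : - `|h| <= along t h <= `|h| by rewrite -ler_norml normr_along.
have p0 : r / 2 < r + along t h by lra.
have pp : 0 < r + along t h by lra.
set q := across t h / (r + along t h).
have qE : (r + along t h) * q = across t h by rewrite /q mulrC divfK// gt_eqF.
have qdl : `|q| < dl.
  rewrite /q normrM normfV ltr_pdivrMr ?normr_gt0 ?gt_eqF// (gtr0_norm pp).
  by apply: (le_lt_trans (normr_across t h)); nra.
have [|Iq Hc Hs] := H q; first by rewrite /ball_/= sub0r normrN.
rewrite !fctE /= (addrC h) (radial_polar_near r0 Iq pp) -/q.
rewrite radial_polar//; last exact: cis_circle.
rewrite psi_lift; last by apply/interval02piP; lra.
set X := cos (psi (t + atan q)) / _ in Hc *; set Y := sin (psi (t + atan q)) / _ in Hs *.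
apply: (le_trans (Rcomplex_normr_le _)).
have -> : e * `|h| = e / 2 * `|h| + e / 2 * `|h| by field.
have bd (Z : R) : `|Z| <= e / 2 * `|q| -> `|(r + along t h) * Z| <= e / 2 * `|h|.
  move=> Zq; rewrite normrM (gtr0_norm pp).
  apply: (@le_trans _ _ ((r + along t h) * (e / 2 * `|q|))); first by rewrite ler_pM2l.
  rewrite mulrCA ler_pM2l//.
  by rewrite -[X in X * _](gtr0_norm pp) -normrM qE normr_across.
apply: lerD.
  have := bd _ Hc; congr (`|_| <= _).
  by rewrite Re_sub Re_scale /= -qE; ring.
have := bd _ Hs; congr (`|_| <= _).
by rewrite Im_sub Im_scale /= -qE; ring.
Unshelve. all: by end_near. Qed.

Lemma sup_max (S : set R) x : S x -> (forall y, S y -> y <= x) -> sup S = x.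
Proof.
move=> Sx Sle; apply/eqP; rewrite eq_le; apply/andP; split.
  by apply: ge_sup => //; exists x.
by apply: ub_le_sup => //; exists x.
Qed.

Lemma inf_min (S : set R) x : S x -> (forall y, S y -> x <= y) -> inf S = x.
Proof.
move=> Sx Sle; apply/eqP; rewrite eq_le; apply/andP; split.
  by apply: ge_inf => //; exists x.
by apply: lb_le_inf => //; exists x.
Qed.

(** The unit vector [i * cis t]. *)
Definition perp t : C := (- sin t +i* cos t)%C.

Lemma normr_polar_diff_cis t phi d : `|polar_diff t phi d (cis t)| = 1.
Proof.
apply/eqP; rewrite -(@eqrXn2 _ 2)// normr_polar_diff /along /across /=.
by rewrite -!expr2 cos2Dsin2 (mulrC (sin t)) subrr expr0n mulr0 addr0.
Qed.

Lemma normr_polar_diff_perp t phi d : `|polar_diff t phi d (perp t)| = `|d|.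
Proof.
apply/eqP; rewrite -(@eqrXn2 _ 2)// normr_polar_diff /along /across /=.
rewrite real_normK ?num_real// mulNr (mulrC (sin t)) addNr expr0n add0r.
by rewrite mulNr opprK -!expr2 cos2Dsin2 expr1n mulr1.
Qed.

Lemma perp_circle t : circle (perp t).
Proof. by rewrite /circle/= Rcomplex_normE /= sqrrN addrC cos2Dsin2 sqrtr1. Qed.

Lemma normr_polar_diff_bounds t phi d h : circle h ->
  Num.min 1 `|d| <= `|polar_diff t phi d h| <= Num.max 1 `|d|.
Proof.
rewrite /circle/= => h1; have := along_across t h; rewrite h1 expr1n => ab.
have m0 : 0 <= Num.min 1 `|d| by rewrite le_min ler01 /=.
have M0 : 0 <= Num.max 1 `|d| by rewrite le_max ler01.
have E := normr_polar_diff t phi d h; rewrite -(real_normK (num_real d)) in E.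
have a0 := sqr_ge0 (along t h); have b0 := sqr_ge0 (across t h).
rewrite -(@ler_pXn2r _ 2) ?nnegrE// -[X in _ && X](@ler_pXn2r _ 2) ?nnegrE// E.
move: ab a0 b0; set a := along t h ^+ 2; set b := across t h ^+ 2 => ab a0 b0.
have d0 := normr_ge0 d.
case: (leP 1 `|d|) => d1.
  have d2 : 1 <= `|d| ^+ 2 by rewrite exprn_ege1.
  by rewrite expr1n; apply/andP; split; nra.
have d2 : `|d| ^+ 2 <= 1 by rewrite expr_le1// ltW.
by rewrite expr1n; apply/andP; split; nra.
Qed.

Lemma distortion_radial t r d : 0 < r -> 0 < t < 2 * pi -> is_derive t 1 psi d ->
  d != 0 -> distortion (radial F) (r *: cis t : C) = (Num.max `|d| `|d|^-1)%:E.
Proof.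
move=> r0 tI dpsi d0; have d0' : 0 < `|d| by rewrite normr_gt0.
have dE := radial_diff r0 tI dpsi.
rewrite /distortion.
have -> : max_stretch (radial F) (r *: cis t) = Num.max 1 `|d|.
  apply: sup_max => [|_ [h ch <-]]; last first.
    by rewrite dE; have /andP[] := normr_polar_diff_bounds t (psi t) d ch.
  case: (leP 1 `|d|) => _.
    by exists (perp t); [exact: perp_circle|rewrite dE normr_polar_diff_perp].
  by exists (cis t); [exact: cis_circle|rewrite dE normr_polar_diff_cis].
have -> : min_stretch (radial F) (r *: cis t) = Num.min 1 `|d|.
  apply: inf_min => [|_ [h ch <-]]; last first.
    by rewrite dE; have /andP[] := normr_polar_diff_bounds t (psi t) d ch.
  case: (leP 1 `|d|) => _.
    by exists (cis t); [exact: cis_circle|rewrite dE normr_polar_diff_cis].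
  by exists (perp t); [exact: perp_circle|rewrite dE normr_polar_diff_perp].
case: (leP 1 `|d|) => d1.
  rewrite inver oner_eq0 -EFinM invr1 mulr1 (max_idPl _)//.
  by rewrite (le_trans _ d1)// invf_le1.
rewrite inver gt_eqF// -EFinM mul1r (max_idPr _)//.
by apply: (le_trans (ltW d1)); rewrite invf_ge1// ltW.
Qed.

End differential.

(** * Upper bounds of Lipschitz constants and essential suprema *)

Section extended_bounds.
Context {R : realType}.
Local Notation C := (Rcomplex R).
Local Notation I := (@interval02pi R).
Local Notation mu := (@lebesgue_measure R).

Lemma ereal_eq_upper_bounds (X Y : \bar R) :
  (forall M : R, (X <= M%:E)%E <-> (Y <= M%:E)%E) -> X = Y.
Proof.
suff le_of (U V : \bar R) :
    (forall M : R, (V <= M%:E)%E -> (U <= M%:E)%E) -> (U <= V)%E.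
  by move=> H; apply/eqP; rewrite eq_le !le_of// => M /H.
case: V => [v|_|H]; [exact|exact: leey|].
case: U H => [u|/(_ 0)|//] H; last by have := H (leNye _).
have : u <= u - 1 by rewrite -lee_fin; apply: H; exact: leNye.
by move=> ?; exfalso; lra.
Qed.

Lemma Lip_leP (V W : normedZmodType R) (A : set V) (g : V -> W) (M : R) :
  (Lip A g <= M%:E)%E <->
  (forall x y, A x -> A y -> `|g x - g y| <= M * `|x - y|).
Proof.
split=> [/ereal_supP H x y Ax Ay|H].
  have [->|/eqP xy] := eqVneq x y; first by rewrite !subrr !normr0 mulr0.
  have := H _ (ex_intro2 _ _ (x, y) (And3 Ax Ay xy) erefl).
  by rewrite lee_fin /= ler_pdivrMr// normr_gt0 subr_eq0; apply/eqP.
apply/ereal_supP => _ [[x y] /= [Ax Ay xy] <-].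
by rewrite lee_fin ler_pdivrMr ?H// normr_gt0 subr_eq0; apply/eqP.
Qed.

Lemma Linf_leP (g : R -> \bar R) (M : R) : (Linf g <= M%:E)%E <->
  {ae mu, forall x, x \in `]0, 2 * pi[%R -> (`|g x| <= M%:E)%E}.
Proof.
have pi0 := pi_gt0 R.
have mI := @measurable_interval02pi R.
rewrite /Linf unlock /= /mrestr setTI.
rewrite lebesgue_measure_itv/= lte_fin mulr_gt0// ?pi0//.
rewrite -EFinB lte_fin subr0 mulr_gt0//.
have m1 (c : R) : mu.-negligible [set c].
  by exists [set c]; split => //; exact: lebesgue_measure_set1.
split=> [/ess_supP [N [mN N0 PN]]|[N [mN N0 PN]]].
  exists (N `&` I); split => //; first exact: measurableI.
  move=> x /= /not_implyP[xI xP]; split; first exact: PN.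
  by move: xI; rewrite in_itv/= => /andP[? ?]; apply/interval02piP; lra.
apply/ess_supP; exists (N `|` ~` `]0, 2 * pi[%classic); split.
- by apply: measurableU => //; apply: measurableC; exact: measurable_itv.
- rewrite /mrestr.
  apply: (@measure_negligible _ _ _ mu).
    apply: measurableI => //; apply: measurableU => //.
    by apply: measurableC; exact: measurable_itv.
  have nN : mu.-negligible N by exists N; split.
  apply: negligibleS (negligibleU nN (negligibleU (m1 0) (m1 (2 * pi)))).
  move=> x [[Nx|nx] /interval02piP/andP[x0 x2]]; first by left.
  right; have [->|xn0] := eqVneq x 0; [by left|right].
  apply/eqP; apply: contrapT => /negP xn2; apply: nx; rewrite /= in_itv/=.
  by rewrite !lt_neqAle x0 x2 eq_sym xn0 xn2.
- move=> x xP; have [xI|xI] := pselect (x \in `]0, 2 * pi[%R); last by right.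
  by left; apply: PN => /= /(_ xI).
Qed.

(** At [d = 0] both sides are false, the inverse of 0 being [+oo]. *)
Lemma abse_inve_le (d M : R) : (`|(d%:E)^-1| <= M%:E)%E = (1 <= M * `|d|).
Proof.
rewrite inver; case: eqVneq => [->|d0].
  by rewrite normr0 mulr0 ler10 /= leye_eq.
by rewrite /= lee_fin normfV -[_^-1]mul1r ler_pdivrMr// normr_gt0.
Qed.

End extended_bounds.

Section derivative_bounds.
Context {R : realType}.
Local Notation C := (Rcomplex R).
Local Notation I := (@interval02pi R).
Local Notation mu := (@lebesgue_measure R).
Variables (psi : R -> R) (K : R).
Hypothesis psi_turn : turn psi \/ turn (\- psi).
Hypothesis psi_lip : forall s t, I s -> I t -> `|psi s - psi t| <= K * `|s - t|.

Let pi2 : 0 < 2 * pi :> R.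
Proof. by rewrite mulr_gt0// pi_gt0. Qed.

Let mono : nondecreasing_on 0 (2 * pi) psi \/ nondecreasing_on 0 (2 * pi) (\- psi).
Proof. by case: psi_turn => -[? _]; [left|right]. Qed.

Let lipK x y : 0 <= x -> x <= y -> y <= 2 * pi -> `|psi y - psi x| <= K * (y - x).
Proof.
move=> x0 xy y2; rewrite -[X in _ <= _ * X](ger0_norm (_ : 0 <= y - x)) ?subr_ge0//.
by apply: psi_lip; apply/interval02piP; lra.
Qed.

(** The orientation [e], equal to 1 or to -1, of [psi]. *)
Let sign : exists e : R, (forall x, `|e * x| = `|x|) /\
  forall s t, 0 <= s -> s <= t -> t <= 2 * pi -> 0 <= e * (psi t - psi s).
Proof.
case: mono => nd; [exists 1|exists (-1)]; split=> [x|s t s0 st t2].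
- by rewrite mul1r.
- by rewrite mul1r subr_ge0 nd.
- by rewrite mulN1r normrN.
- by rewrite mulN1r; have := nd s t s0 st t2; rewrite /=; lra.
Qed.

Let orderedP (P : R -> R -> Prop) :
  (forall s t, P s t -> P t s) ->
  (forall s t, I s -> I t -> P s t) <->
  (forall s t, 0 <= s -> s <= t -> t <= 2 * pi -> P s t).
Proof.
move=> sym; split=> H s t.
  by move=> s0 st t2; apply: H; apply/interval02piP; lra.
move=> /interval02piP/andP[? ?] /interval02piP/andP[? ?].
by have [st|/ltW ts] := leP s t; [|apply: sym]; apply: H; lra.
Qed.

Let ae_iff (P Q : R -> Prop) : {ae mu, forall x, P x <-> Q x} ->
  {ae mu, forall x, P x} <-> {ae mu, forall x, Q x}.
Proof.
move=> PQ; split=> H; move: PQ H; apply: filterS2;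
  do ?[exact: (ae_filter_ringOfSetsType mu)].
- by move=> x [].
- by move=> x [].
Qed.

Lemma ae_derivable : {ae mu, forall x, x \in `]0, 2 * pi[%R -> derivable psi x 1}.
Proof.
have [g [_ _]] := lipschitz_monotone_FTC pi2 mono lipK.
apply: filterS; first exact: (ae_filter_ringOfSetsType mu).
by move=> x gx xI; have [] := gx xI.
Qed.

Lemma lip_derive M : (forall s t, I s -> I t -> `|psi s - psi t| <= M * `|s - t|) <->
  {ae mu, forall x, x \in `]0, 2 * pi[%R -> `|derive1 psi x| <= M}.
Proof.
have [e [en e0]] := sign.
rewrite orderedP; last by move=> s t; rewrite distrC (distrC s).
have D0 : {ae mu, forall x, x \in `]0, 2 * pi[%R -> 0 <= e * derive1 psi x}.
  by apply/(ae_derive_ge _ _ pi2 mono lipK) => s t *; rewrite mul0r e0.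
transitivity (forall s t, 0 <= s -> s <= t -> t <= 2 * pi ->
    (- M) * (t - s) <= (- e) * (psi t - psi s)).
  split=> H s t s0 st t2; have := H s t s0 st t2; have := e0 s t s0 st t2;
    rewrite -en -(normrN (e * _)) -mulrN opprB => h;
    rewrite (ger0_norm h) distrC (ger0_norm (_ : 0 <= t - s)) ?subr_ge0//; lra.
rewrite (ae_derive_ge _ _ pi2 mono lipK).
apply: ae_iff; move: D0; apply: filterS; first exact: (ae_filter_ringOfSetsType mu).
move=> x Dx; split=> H xI; have := H xI; have := Dx xI; rewrite -en => h;
  rewrite ger0_norm//; lra.
Qed.

Lemma expand_derive M : (forall s t, I s -> I t -> `|s - t| <= M * `|psi s - psi t|) <->
  {ae mu, forall x, x \in `]0, 2 * pi[%R -> 1 <= M * `|derive1 psi x|}.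
Proof.
have [e [en e0]] := sign.
rewrite orderedP; last by move=> s t; rewrite distrC (distrC (psi s)).
have D0 : {ae mu, forall x, x \in `]0, 2 * pi[%R -> 0 <= e * derive1 psi x}.
  by apply/(ae_derive_ge _ _ pi2 mono lipK) => s t *; rewrite mul0r e0.
transitivity (forall s t, 0 <= s -> s <= t -> t <= 2 * pi ->
    1 * (t - s) <= (M * e) * (psi t - psi s)).
  split=> H s t s0 st t2; have := H s t s0 st t2; have := e0 s t s0 st t2;
    rewrite (distrC (psi s)) -(en (psi t - psi s)) => h;
    rewrite (ger0_norm h) distrC (ger0_norm (_ : 0 <= t - s)) ?subr_ge0//; lra.
rewrite (ae_derive_ge _ _ pi2 mono lipK).
apply: ae_iff; move: D0; apply: filterS; first exact: (ae_filter_ringOfSetsType mu).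
move=> x Dx; split=> H xI; have := H xI; have := Dx xI; rewrite -en => h;
  rewrite ger0_norm//; lra.
Qed.

End derivative_bounds.

(** * The essential supremum of the distortion *)

Section distortion_bound.
Context {R : realType}.
Local Notation C := (Rcomplex R).
Local Notation I := (@interval02pi R).
Local Notation mu := (@lebesgue_measure R).
Variables (F : C -> C) (psi : R -> R).
Hypothesis psi_lift : forall x, I x -> F (cis x) = cis (psi x).
Hypothesis psi_regular : {ae mu, forall t, t \in `]0, 2 * pi[%R ->
  derivable psi t 1 /\ derive1 psi t != 0}.

Lemma ess_sup_distortion_leP (M : R) :
  (ess_sup_plane (distortion (radial F)) <= M%:E)%E <->
  {ae mu, forall t, t \in `]0, 2 * pi[%R ->
    `|derive1 psi t| <= M /\ 1 <= M * `|derive1 psi t|}.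
Proof.
have E (r t : R) : 0 < r -> t \in `]0, 2 * pi[%R ->
    derivable psi t 1 -> derive1 psi t != 0 ->
    (distortion (radial F) ((r * cos t)%R +i* (r * sin t)%R)%C <= M%:E)%E <->
    `|derive1 psi t| <= M /\ 1 <= M * `|derive1 psi t|.
  rewrite in_itv => r0 tI dpsi d0.
  have isd : is_derive t 1 psi (derive1 psi t).
    by rewrite derive1E; exact: derivableP.
  have -> : ((r * cos t)%R +i* (r * sin t)%R)%C = r *: (cis t : C) by [].
  rewrite (distortion_radial psi_lift r0 tI isd d0) lee_fin ge_max.
  rewrite -[_^-1]mul1r ler_pdivrMr ?normr_gt0//.
  by split => [/andP[]|[-> ->]].
split=> [/ess_supP H|H].
  have : {ae mu, forall t, t \in `]0, 2 * pi[%R ->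
      derivable psi t 1 /\ derive1 psi t != 0 ->
      `|derive1 psi t| <= M /\ 1 <= M * `|derive1 psi t|}.
    apply: ae_plane_polar H => r t r0 tI Q [dpsi d0].
    exact: (E r t r0 tI dpsi d0).1.
  move: psi_regular; apply: filterS2; first exact: (ae_filter_ringOfSetsType mu).
  by move=> t reg Ht tI; exact: Ht (reg tI).
apply/ess_supP.
have : {ae mu, forall t, t \in `]0, 2 * pi[%R ->
    (derivable psi t 1 /\ derive1 psi t != 0) /\
    (`|derive1 psi t| <= M /\ 1 <= M * `|derive1 psi t|)}.
  move: psi_regular H; apply: filterS2; first exact: (ae_filter_ringOfSetsType mu).
  by move=> t reg Ht tI; split; [exact: reg|exact: Ht].
apply: ae_polar_plane => r t r0 tI [[dpsi d0] Hb].
exact: (E r t r0 tI dpsi d0).2.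
Qed.

End distortion_bound.

Theorem theorem2p2 (R : realType) (F : Rcomplex R -> Rcomplex R) (psi : R -> R)
    (F_circle : forall z, circle z -> circle (F z))
    (F_bilip : bilipschitz_on circle F)
    (psi_continuous : {within interval02pi, continuous psi})
    (psi_lift : forall x, interval02pi x -> F (cis x) = cis (psi x)) :
  let f : R -> Rcomplex R := fun t => F (cis t) in
  let w : Rcomplex R -> Rcomplex R := radial F in
  let w_inv : Rcomplex R -> Rcomplex R := 'pinv_(fun=> 0) setT w in
  let psi_inv : R -> R := 'pinv_(fun=> 0) interval02pi psi in
  let dpsi : R -> \bar R := fun x => (derive1 psi x)%:E in
  let dpsi_inv : R -> \bar R := fun x => ((dpsi x)^-1)%E in
  let l : \bar R := Lip interval02pi f in
  let L : \bar R := Lip circle F in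
  let Lambda : \bar R := Lip setT w in
  let K : \bar R := ess_sup_plane (distortion w) in
  [/\ [/\ l = L, L = Lambda, Lambda = Lip interval02pi psi
        & Lip interval02pi psi = Linf dpsi],
      Lip setT w_inv = Lip (psi @` interval02pi) psi_inv
        /\ Lip (psi @` interval02pi) psi_inv = Linf dpsi_inv
    & K = Order.max (Linf dpsi) (Linf dpsi_inv)].
Proof.
move=> f w w_inv psi_inv dpsi dpsi_inv l L Lambda K.
have T := psi_turn F_bilip psi_continuous psi_lift.
have inj := psi_inj F_bilip psi_continuous psi_lift.
have [l0 [L0 [l0_gt0 _ F_bounds]]] := F_bilip.
pose lipF M := forall z1 z2, circle z1 -> circle z2 -> `|F z1 - F z2| <= M * `|z1 - z2|.
pose lippsi M := forall s t, interval02pi s -> interval02pi t ->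
  `|psi s - psi t| <= M * `|s - t|.
pose exppsi M := forall s t, interval02pi s -> interval02pi t ->
  `|s - t| <= M * `|psi s - psi t|.
have F_f M : lipF M -> forall s t, interval02pi s -> interval02pi t ->
    `|f s - f t| <= M * `|s - t|.
  move=> H s t _ _.
  have M0 : 0 <= M.
    have := H (cis 0) (cis pi) (cis_circle _) (cis_circle _).
    rewrite chordE sub0r mulNr sinN normrN sin_pihalf normr1 mulr1.
    by move=> /(le_trans (normr_ge0 _)); rewrite pmulr_lge0.
  apply: (le_trans (H _ _ (cis_circle _) (cis_circle _))).
  by rewrite ler_wpM2l// chord_le_dist.
have fP M : (l <= M%:E)%E <-> lippsi M.
  rewrite Lip_leP; split.
    exact: (lip_psi_of_f F_bilip psi_continuous psi_lift).
  by move=> /(lip_F_of_psi F_bilip psi_continuous psi_lift); exact: F_f.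
have FP M : (L <= M%:E)%E <-> lippsi M.
  rewrite Lip_leP; split=> [|H].
    move=> /F_f; exact: (lip_psi_of_f F_bilip psi_continuous psi_lift).
  exact: (lip_F_of_psi F_bilip psi_continuous psi_lift).
have wP M : (Lambda <= M%:E)%E <-> lippsi M.
  rewrite Lip_leP; split=> H.
    apply/FP/Lip_leP => z1 z2 c1 c2.
    by rewrite -(radial_circle F c1) -(radial_circle F c2); exact: H.
  move=> z1 z2 _ _; apply: lip_radial => //.
    exact: (lip_ge1 F_bilip psi_continuous psi_lift H).
  exact: (lip_F_of_psi F_bilip psi_continuous psi_lift).
have psiP M : (Lip interval02pi psi <= M%:E)%E <-> lippsi M by exact: Lip_leP.
have lip0 : lippsi L0.
  apply/FP/Lip_leP => z1 z2 c1 c2.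
  by have /andP[] := F_bounds _ _ c1 c2.
have exp0 : exppsi l0^-1.
  apply: (expand_psi_of_F F_bilip psi_continuous psi_lift) => z1 z2 c1 c2.
  by rewrite ler_pdivlMl//; have /andP[] := F_bounds _ _ c1 c2.
have dP M : (Linf dpsi <= M%:E)%E <-> lippsi M.
  by rewrite Linf_leP /dpsi /= -(lip_derive T lip0).
have psi_invP M : (Lip (psi @` interval02pi) psi_inv <= M%:E)%E <-> exppsi M.
  have psi_invK x : interval02pi x -> psi_inv (psi x) = x.
    by move=> xI; apply: pinvKV; rewrite ?inE// => y z; rewrite !inE; exact: inj.
  rewrite Lip_leP; split=> [H s t Is It|H _ _ [s Is <-] [t It <-]].
    rewrite -{1}(psi_invK _ Is) -{1}(psi_invK _ It).
    by apply: H; [exists s|exists t].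
  by rewrite !psi_invK//; exact: H.
have w_invP M : (Lip setT w_inv <= M%:E)%E <-> exppsi M.
  have w_invK z : w_inv (w z) = z.
    apply: pinvKV; rewrite ?inE// => y y' _ _.
    exact: (radial_inj F_circle F_bilip).
  rewrite Lip_leP; split=> H.
    apply: (expand_psi_of_F F_bilip psi_continuous psi_lift) => z1 z2 c1 c2.
    rewrite -(radial_circle F c1) -(radial_circle F c2).
    by rewrite -{1}(w_invK z1) -{1}(w_invK z2); exact: H.
  move=> u1 u2 _ _.
  have [z1 <-] := radial_surj F_bilip psi_continuous psi_lift u1.
  have [z2 <-] := radial_surj F_bilip psi_continuous psi_lift u2.
  rewrite !w_invK; apply: expand_radial => //.
    exact: (expand_ge1 F_bilip psi_continuous psi_lift H).
  exact: (expand_F_of_psi F_bilip psi_continuous psi_lift).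
have d_invP M : (Linf dpsi_inv <= M%:E)%E <-> exppsi M.
  rewrite Linf_leP /exppsi (expand_derive T lip0).
  by split; (apply: filterS;
    first exact: (ae_filter_ringOfSetsType (@lebesgue_measure R))) => x Hx xI;
    have := Hx xI; rewrite /dpsi_inv abse_inve_le.
(* the derivative vanishes almost nowhere, as psi expands distances *)
have reg : {ae (@lebesgue_measure R), forall t, t \in `]0, 2 * pi[%R ->
    derivable psi t 1 /\ derive1 psi t != 0}.
  have := (expand_derive T lip0 _).1 exp0.
  move: (ae_derivable T lip0); apply: filterS2.
    exact: (ae_filter_ringOfSetsType (@lebesgue_measure R)).
  move=> t dt et tI; split; first exact: dt.
  apply/eqP => d0; have := et tI; rewrite d0 normr0 mulr0; lra.
have KP M : (K <= M%:E)%E <-> lippsi M /\ exppsi M.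
  rewrite /K (ess_sup_distortion_leP psi_lift reg).
  rewrite /lippsi /exppsi (lip_derive T lip0) (expand_derive T lip0).
  split=> [H|[H1 H2]].
    by split; move: H; (apply: filterS;
      first exact: (ae_filter_ringOfSetsType (@lebesgue_measure R))) => t Ht tI;
      have [] := Ht tI.
  move: H1 H2; apply: filterS2.
    exact: (ae_filter_ringOfSetsType (@lebesgue_measure R)).
  by move=> t H1 H2 tI; split; [exact: H1|exact: H2].
split.
- split; apply: ereal_eq_upper_bounds => M.
  + by rewrite fP FP.
  + by rewrite FP wP.
  + by rewrite wP psiP.
  + by rewrite psiP dP.
- split; apply: ereal_eq_upper_bounds => M.
  + by rewrite w_invP psi_invP.
  + by rewrite psi_invP d_invP.
- apply: ereal_eq_upper_bounds => M.
  rewrite KP ge_max; split=> [[/dP -> /d_invP ->]//|/andP[/dP ? /d_invP ?]].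
  by split.
Qed.
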